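(* Let $K$ be an infinite field and let $N\ge 1$. Then the spine $G_N^*$ is a subgraph of the $T$-graph $G_N(K)$ of $\mathrm{Hilb}^N(\mathbb A^2)$. That is: let $a,b$ be positive integers, grade $S=K[x,y]$ by $\deg(x)=a$, $\deg(y)=b$, let $h:\mathbb Z_{\ge 0}\to\mathbb Z_{\ge 0}$ be a function with $\sum_{d\ge 0}h(d)=N$ that is the Hilbert function of at least one homogeneous ideal of $S$, and let $M^-$ and $M^+$ be the lex-least and lex-most monomial ideals with respect to this grading and Hilbert function. Then there exists an ideal $I\subseteq K[x,y]$, homogeneous with respect to this grading and with Hilbert function $h$, such that the closure in $\mathrm{Hilb}^N(\mathbb A^2)$ of the $T$-orbit of $I$ contains $M^-$ and $M^+$.
   Context: $\mathrm{Hilb}^N(\mathbb A^2)$ is the Hilbert scheme over $K$ of length-$N$ subschemes of $\mathbb A^2$; its $K$-rational points are the ideals $I\subseteq S=K[x,y]$ with $\dim_K S/I=N$. The torus $T\cong (K^* )^2$ acts on $\mathbb A^2$ by scaling the coordinates, and hence acts on $\mathrm{Hilb}^N(\mathbb A^2)$. The $T$-fixed points are exactly the monomial ideals of colength $N$. The $T$-graph $G_N(K)$ has as vertices the $T$-fixed points of $\mathrm{Hilb}^N(\mathbb A^2)$, with an edge between two (distinct) vertices if there is a one-dimensional $T$-orbit containing a $K$-rational point whose closure contains these two vertices. For a grading $\deg(x)=a$, $\deg(y)=b$ with $a,b$ positive integers, the Hilbert function of a homogeneous ideal $I$ is $h(d)=\dim_K (S/I)_d$. Let $\prec$ be the lexicographic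 order on monomials with $x\prec y$ (so of two distinct monomials of the same degree the one with the larger exponent of $y$ is larger). For monomial ideals $M,M'$ with the same Hilbert function $h$ (with respect to the given grading), write $M\preceq M'$ if there is a degree-preserving bijection $f$ from the monomials in $M$ to the monomials in $M'$ with $m\succeq f(m)$ for all monomials $m\in M$. This is a partial order on the monomial ideals with Hilbert function $h$; it is known that, when this set is nonempty, it has a unique maximal element $M^+$ (the lex-most ideal) and a unique minimal element $M^-$ (the lex-least ideal). The spine $G_N^*$ is the graph whose vertices are the monomial ideals of colength $N$ (the $T$-fixed points of $\mathrm{Hilb}^N(\mathbb A^2)$), with an edge between two (distinct) monomial ideals if they are the lex-most and lex-least ideals with respect to some grading $\deg(x)=a,\deg(y)=b$ with $a,b>0$ and some Hilbert function $h$ with $\sum_d h(d)=N$. *)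

(* Defs.v *)
From HB Require Import structures.
From mathcomp Require Import all_boot all_order all_algebra.
From mathcomp Require Export mpoly.
From mathcomp Require Export boolp classical_sets functions cardinality.

Set Implicit Arguments.
Unset Strict Implicit.
Unset Printing Implicit Defensive.

Import GRing.Theory.

Local Open Scope classical_set_scope.
Local Open Scope ring_scope.

(* S = K[x,y] is {mpoly K[2]}, with x = 'X_ord0 and y = 'X_ord_max.           *)
(* Ideals, and the points of the Hilbert scheme, are sets of polynomials.     *)

Definition is_ideal (K : fieldType) (I : set {mpoly K[2]}) : Prop :=
  [/\ I 0, forall p q, I p -> I q -> I (p + q) & forall r p, I p -> I (r * p)].

(* For a subspace V, the classes of the B i form a K-basis of V / (V `&` I).  *)
Definition basis_mod (K : fieldType) (V I : set {mpoly K[2]}) (n : nat)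
    (B : 'I_n -> {mpoly K[2]}) : Prop :=
  (forall i, V (B i)) /\
  forall p, V p -> exists! c : {ffun 'I_n -> K}, I (p - \sum_i c i *: B i).

Definition dim_mod (K : fieldType) (V I : set {mpoly K[2]}) (n : nat) : Prop :=
  exists B : 'I_n -> {mpoly K[2]}, basis_mod V I B.

(* The K-rational points of Hilb^N(A^2). *)
Definition hilb (K : fieldType) (N : nat) : set (set {mpoly K[2]}) :=
  [set I | is_ideal I /\ dim_mod setT I N].

Definition monomial_ideal (K : fieldType) (M : set {mpoly K[2]}) : Prop :=
  exists G : set 'X_{1..2}, M = smallest (@is_ideal K) [set 'X_[m] | m in G].

Definition wdeg (a b : nat) (m : 'X_{1..2}) : nat :=
  (a * m ord0 + b * m ord_max)%N.

Fact wdeg0 (a b : nat) : wdeg a b 0%MM = 0%N.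
Proof. by rewrite /wdeg !mnm0E !muln0. Qed.

Fact wdegD (a b : nat) :
  {morph wdeg a b : m1 m2 / (m1 + m2)%MM >-> (m1 + m2)%N}.
Proof. by move=> m1 m2; rewrite /wdeg !mnmDE !mulnDr addnACA. Qed.

HB.instance Definition _ (a b : nat) :=
  isMeasure.Build 2 (wdeg a b) (wdeg0 a b) (@wdegD a b).

Definition homogeneous (K : fieldType) (a b : nat) (I : set {mpoly K[2]}) :
    Prop :=
  forall d p, I p -> I (pihomog (wdeg a b) d p).

Definition hilbert_function (K : fieldType) (a b : nat) (I : set {mpoly K[2]})
    (h : nat -> nat) : Prop :=
  forall d, dim_mod [set p | p \is d.-homog for (wdeg a b)] I (h d).

(* The sum of all the values of h is finite, equal to N. *)
Definition sums_to (h : nat -> nat) (N : nat) : Prop :=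
  exists D0, forall D, (D0 <= D)%N -> (\sum_(d < D) h d = N)%N.

(* The lexicographic order with x smaller than y. *)
Definition lexle (m m' : 'X_{1..2}) : bool :=
  ((m ord_max < m' ord_max) ||
   ((m ord_max == m' ord_max) && (m ord0 <= m' ord0)))%N.

Definition monomials (K : fieldType) (M : set {mpoly K[2]}) : set 'X_{1..2} :=
  [set m | M 'X_[m]].

Definition mon_le (K : fieldType) (a b : nat) (M M' : set {mpoly K[2]}) :
    Prop :=
  exists f : 'X_{1..2} -> 'X_{1..2},
    set_bij (monomials M) (monomials M') f /\
    forall m, monomials M m -> wdeg a b (f m) = wdeg a b m /\ lexle (f m) m.

Definition mon_hilb (K : fieldType) (a b : nat) (h : nat -> nat) :
    set (set {mpoly K[2]}) :=
  [set M | monomial_ideal M /\ hilbert_function a b M h].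

Definition lex_most (K : fieldType) (a b : nat) (h : nat -> nat)
    (M : set {mpoly K[2]}) : Prop :=
  mon_hilb a b h M /\
  forall M', mon_hilb a b h M' -> mon_le a b M M' -> M' = M.

Definition lex_least (K : fieldType) (a b : nat) (h : nat -> nat)
    (M : set {mpoly K[2]}) : Prop :=
  mon_hilb a b h M /\
  forall M', mon_hilb a b h M' -> mon_le a b M' M -> M' = M.

(* Zariski topology on hilb K N. For a family B of N monomials, the ideals I  *)
(* such that B is a basis of S / I form an affine open subscheme U_B of       *)
(* Hilb^N(A^2), and these cover it. The coordinate ring of U_B is generated   *)
(* by the functions I |-> C m i, where 'X_[m] = \sum_i C m i *: 'X_[B i] in   *)
(* S / I. A set of K-points is closed when its trace on each U_B is the zero  *)
(* locus of a family of polynomials in these coordinates.                     *)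
Definition chart_coords (K : fieldType) (N : nat) (B : 'I_N -> 'X_{1..2})
    (I : set {mpoly K[2]}) (C : 'X_{1..2} -> 'I_N -> K) : Prop :=
  basis_mod setT I (fun i => 'X_[B i]) /\
  forall m, I ('X_[m] - \sum_i C m i *: 'X_[B i]).

Definition chart_functions (K : fieldType) (N : nat) :
    set (('X_{1..2} -> 'I_N -> K) -> K) :=
  [set F | exists n (v : 'I_n -> 'X_{1..2} * 'I_N) (P : {mpoly K[n]}),
             F = fun C => P.@[fun j => C (v j).1 (v j).2]].

Definition zariski_closed (K : fieldType) (N : nat)
    (Z : set (set {mpoly K[2]})) : Prop :=
  Z `<=` @hilb K N /\
  forall B : 'I_N -> 'X_{1..2},
    exists2 E : set (('X_{1..2} -> 'I_N -> K) -> K),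
      E `<=` @chart_functions K N &
      forall I C, hilb N I -> chart_coords B I C ->
        (Z I <-> forall F, E F -> F C = 0).

Definition zariski_closure (K : fieldType) (N : nat)
    (A : set (set {mpoly K[2]})) : set (set {mpoly K[2]}) :=
  smallest (@zariski_closed K N) A.

(* Krull dimension of A, a set of K-points with the subspace topology. *)
Definition closed_in (K : fieldType) (N : nat)
    (A C : set (set {mpoly K[2]})) : Prop :=
  exists2 Z, zariski_closed N Z & C = A `&` Z.

Definition zariski_irreducible (K : fieldType) (N : nat)
    (C : set (set {mpoly K[2]})) : Prop :=
  C !=set0 /\
  forall Z1 Z2, zariski_closed N Z1 -> zariski_closed N Z2 ->
    C `<=` Z1 `|` Z2 -> C `<=` Z1 \/ C `<=` Z2.

Definition krull_dim_ge (K : fieldType) (N : nat)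
    (A : set (set {mpoly K[2]})) (n : nat) : Prop :=
  exists C : nat -> set (set {mpoly K[2]}),
    (forall i, (i <= n)%N -> closed_in N A (C i) /\ zariski_irreducible N (C i))
    /\ (forall i, (i < n)%N -> C i `<` C i.+1).

Definition krull_dim (K : fieldType) (N : nat)
    (A : set (set {mpoly K[2]})) (n : nat) : Prop :=
  krull_dim_ge N A n /\ ~ krull_dim_ge N A n.+1.

(* The action of (s, t) sends (x, y) to (s x, t y) on the plane, so it sends  *)
(* the subscheme of I to that of the ideal of the p with p(s x, t y) in I.    *)
Definition torus_act (K : fieldType) (s t : K) (I : set {mpoly K[2]}) :
    set {mpoly K[2]} :=
  [set p | I (p \mPo [tuple s *: 'X_ord0; t *: 'X_ord_max])].

(* For K infinite the K-points of the torus are dense in it, so this set has  *)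
(* the same closure and the same dimension as the orbit in the scheme.        *)
Definition torus_orbit (K : fieldType) (I : set {mpoly K[2]}) :
    set (set {mpoly K[2]}) :=
  [set J | exists s t : K, [/\ s != 0, t != 0 & J = torus_act s t I]].

Definition torus_fixed (K : fieldType) (I : set {mpoly K[2]}) : Prop :=
  forall s t : K, s != 0 -> t != 0 -> torus_act s t I = I.

Record graph (V : Type) := Graph { vertex : set V; edge : V -> V -> Prop }.

Definition subgraph (V : Type) (G H : graph V) : Prop :=
  vertex G `<=` vertex H /\ forall u v, edge G u v -> edge H u v.

Definition T_graph (K : fieldType) (N : nat) : graph (set {mpoly K[2]}) :=
  {| vertex := [set M | hilb N M /\ torus_fixed M];
     edge M M' :=
       [/\ hilb N M /\ torus_fixed M, hilb N M' /\ torus_fixed M', M <> M' &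
         exists I, [/\ hilb N I, krull_dim N (torus_orbit I) 1,
           zariski_closure N (torus_orbit I) M &
           zariski_closure N (torus_orbit I) M']] |}.

Definition spine (K : fieldType) (N : nat) : graph (set {mpoly K[2]}) :=
  {| vertex := [set M | monomial_ideal M /\ hilb N M];
     edge M M' :=
       M <> M' /\
       exists (a b : nat) (h : nat -> nat),
         [/\ (0 < a)%N, (0 < b)%N, sums_to h N &
           (lex_most a b h M /\ lex_least a b h M') \/
           (lex_least a b h M /\ lex_most a b h M')] |}.

(* Main.v *)
Require Import Defs.
From mathcomp Require Import all_boot all_order all_algebra.
From mathcomp Require Import fingroup perm zify ring.
From mathcomp Require finmap.

(** Fix the grading and let M-, M+ be the lex-least and lex-most ideals. Any
    homogeneous ideal I has two monomial degenerations, its initial ideals for the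
    order in which, within a degree, the monomial with the larger exponent of x
    (respectively of y) leads; they are the limits of I under one-parameter
    subgroups scaling one variable ([init_limit], [torus_limit]). So it is enough to
    find I with Hilbert function h whose two initial ideals are M+ and M-.

    It suffices in turn that the monomials outside M+, and also those outside M-, form
    a basis of S / I. Indeed, the monomials outside an initial ideal are the greedy basis
    of S / I: in each degree and below any bound on the exponent they are at least
    as many as those of another basis ([init_greedy]). Matching monomials in order
    turns these inequalities into the bijections that define the partial order
    ([dominating_bij]), and the maximality of M+ and minimality of M- force equality
    ([lex_most_init], [lex_least_init]).

    Being a basis of S / I is an open condition on I, so a general member of a
    flat family through M+ and M- will do ([common_ideal]). The family comes from
    the Hilbert-Burch resolution. A monomial ideal of finite colength is generated by
    the maximal minors of the bidiagonal matrix of the relations between neighbouring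
    generators x^(lam j) y^j. As M+ and M- have the same Hilbert function, the
    degrees of the generators of one and the relations of the other are, as multisets,
    those obtained by exchanging the two ideals ([perm_of_sums], [sum_gens]). Hence,
    after adding generators that cancel against relations, the two matrices have the
    same row and column degrees, and [interp] is the line through them. The maximal
    minors at a general point of the line generate an ideal with the
    Hilbert function h: the products of minors that specialize to the monomials of M+
    (or M-) stay independent, by a determinant in the parameter, and there are no
    further elements because the columns of the matrix are independent relations
    between the minors ([minor_free], a count of dimensions in low degrees).

    For the T-graph the orbit of I must have dimension 1. In a chart
    the torus scales the coordinates of I by powers of a single character chi, as I is
    homogeneous. So the trace on the orbit of a closed set is given by Laurent
    polynomials in chi, and a proper closed subset is finite ([closed_dichotomy],
    [orbit_dim]). If I were fixed by the torus, it would be its own orbit closure,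
    and M+ = I = M- ([fixed_closure]). *)

Set Implicit Arguments.
Unset Strict Implicit.
Unset Printing Implicit Defensive.

Import GRing.Theory.

Local Open Scope classical_set_scope.
Local Open Scope ring_scope.

(** * Families of vectors, monomials and supports *)

(** This is the only input from the theory of rank: all the comparisons of dimensions
    below exhibit an independent family of vectors indexed by X with coordinates
    indexed by F. *)
Lemma card_free_le (K : fieldType) (X F : finType) (u : X -> F -> K) :
  (forall c : X -> K, (forall f, \sum_x c x * u x f = 0) -> forall x, c x = 0) ->
  (#|X| <= #|F|)%N.
Proof.
move=> indep; pose A := \matrix_(i < #|X|, j < #|F|) u (enum_val i) (enum_val j).
suff: row_free A by rewrite /row_free => /eqP <-; exact: rank_leq_col.
apply/row_freeP; apply: contrapT => nfree.
have : kermx A != 0.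
  apply: contra_notN nfree => /eqP ker0.
  by apply/row_freeP; rewrite -kermx_eq0 ker0.
case/matrix0Pn => i [j]; rewrite -(enum_valK j) => /eqP[].
pose c x := kermx A i (enum_rank x).
apply: (indep c) => f; have := mulmx_ker A.
move/matrixP/(_ i (enum_rank f)); rewrite !mxE => e.
rewrite -[RHS]e [RHS](reindex (@enum_rank X)) /=; last exact: onW_bij (enum_rank_bij X).
by apply: eq_big => // x _; rewrite [A _ _]mxE !enum_rankK.
Qed.

(** The monomial x^p y^q. *)
Definition mn (p q : nat) : 'X_{1..2} := [multinom [tuple p; q]].

Lemma mn0 p q : mn p q ord0 = p. Proof. by []. Qed.

Lemma mn1 p q : mn p q ord_max = q. Proof. by []. Qed.

Lemma ord2 (i : 'I_2) : i = ord0 \/ i = ord_max.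
Proof. by case: i => [[|[|//]] h]; [left|right]; apply: val_inj. Qed.

Lemma mon_eq (m m' : 'X_{1..2}) :
  m ord0 = m' ord0 -> m ord_max = m' ord_max -> m = m'.
Proof. by move=> h0 h1; apply/mnmP => i; case: (ord2 i) => ->. Qed.

Lemma mnE (m : 'X_{1..2}) : m = mn (m ord0) (m ord_max).
Proof. by apply: mon_eq; rewrite ?mn0 ?mn1. Qed.

Lemma mnD p q p' q' : (mn p q + mn p' q')%MM = mn (p + p') (q + q').
Proof. by apply: mon_eq; rewrite mnmDE ?mn0 ?mn1. Qed.

Lemma mn_inj : injective (fun x : nat * nat => mn x.1 x.2).
Proof.
move=> [p q] [p' q'] /= e.
by congr pair; [rewrite -[p](mn0 p q)|rewrite -[q](mn1 p q)]; rewrite e.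
Qed.

Lemma wdeg_mn a b p q : wdeg a b (mn p q) = (a * p + b * q)%N.
Proof. by []. Qed.


Lemma natb_neq0 (R : nzRingType) (b : bool) : (b%:R != 0 :> R) = b.
Proof. by case: b; rewrite ?oner_eq0 ?eqxx. Qed.

Section Supports.

Variable R : idomainType.
Implicit Types (p q : {mpoly R[2]}) (m u : 'X_{1..2}) (U V : set 'X_{1..2}).

Definition supp_in U p := forall m, p@_m != 0 -> U m.

Lemma supp_in_sub U V p : U `<=` V -> supp_in U p -> supp_in V p.
Proof. by move=> UV h m /h; apply: UV. Qed.

Lemma supp_in0 U : supp_in U 0.
Proof. by move=> m; rewrite mcoeff0 eqxx. Qed.

Lemma supp_inD U p q : supp_in U p -> supp_in U q -> supp_in U (p + q).
Proof.
move=> hp hq m; rewrite mcoeffD; have [->|/hp //] := eqVneq p@_m 0.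
by rewrite add0r => /hq.
Qed.

Lemma supp_inZ U c p : supp_in U p -> supp_in U (c *: p).
Proof.
move=> hp m; rewrite mcoeffZ; have [->|/hp //] := eqVneq p@_m 0.
by rewrite mulr0 eqxx.
Qed.

Lemma supp_inN U p : supp_in U p -> supp_in U (- p).
Proof. by rewrite -scaleN1r; apply: supp_inZ. Qed.

Lemma supp_inB U p q : supp_in U p -> supp_in U q -> supp_in U (p - q).
Proof. by move=> hp hq; apply: supp_inD => //; apply: supp_inN. Qed.

Lemma supp_in_sum U (I : Type) (r : seq I) (P : pred I) (F : I -> {mpoly R[2]}) :
  (forall i, P i -> supp_in U (F i)) -> supp_in U (\sum_(i <- r | P i) F i).
Proof.
move=> h; apply: (big_ind (supp_in U)) => //; first exact: supp_in0.
exact: supp_inD.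
Qed.

Lemma supp_inX U m : U m -> supp_in U 'X_[m].
Proof. by move=> Um m'; rewrite mcoeffX natb_neq0 => /eqP <-. Qed.

Lemma mcoeffM_neq0 p q m : (p * q)@_m != 0 ->
  exists u v, [/\ m = (u + v)%MM, p@_u != 0 & q@_v != 0].
Proof.
rewrite -mcoeff_msupp => /msuppM_le/allpairsP[[u v] /= [hu hv ->]].
by exists u, v; rewrite -!mcoeff_msupp.
Qed.

Lemma mcoeffXM_neq0 m u p : ('X_[u] * p)@_m != 0 ->
  exists2 v, m = (u + v)%MM & p@_v != 0.
Proof.
move=> /mcoeffM_neq0[u' [v [-> + hv]]].
by rewrite mcoeffX natb_neq0 => /eqP ->; exists v.
Qed.

Lemma mpoly_neq0 p : p != 0 -> exists m, p@_m != 0.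
Proof.
move=> /negP np; apply: contrapT => h; apply/np/eqP/mpolyP => m.
by rewrite mcoeff0; apply/eqP/negPn/negP => hm; apply: h; exists m.
Qed.

Lemma mpoly_sumE (s : seq 'X_{1..2}) p : uniq s ->
  supp_in [set` s] p -> p = \sum_(m <- s) p@_m *: 'X_[m].
Proof.
move=> us ps; apply/mpolyP => m; rewrite raddf_sum /=.
have [ms|/negP nms] := boolP (m \in s).
  rewrite (bigD1_seq m) //= mcoeffZ mcoeffX eqxx mulr1 big1 ?addr0 // => m' /negPf n.
  by rewrite mcoeffZ mcoeffX n mulr0.
rewrite big_seq big1 => [|m' m's].
  by apply/eqP/negPn/negP => /ps.
rewrite mcoeffZ mcoeffX; case: eqP => [e|]; last by rewrite mulr0.
by rewrite e in m's; case: nms.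
Qed.

Lemma mcoeff_pihomog (f : measure 2) d p m :
  (pihomog f d p)@_m = if f m == d then p@_m else 0.
Proof.
rewrite pihomogE raddf_sum /=; have [mp|/negP nmp] := boolP (m \in msupp p); last first.
  have -> : p@_m = 0 by apply/eqP; rewrite mcoeff_eq0; apply/negP.
  rewrite if_same big_seq_cond big1 // => m' /andP[m'p _].
  rewrite mcoeffZ mcoeffX; case: eqP => [e|]; last by rewrite mulr0.
  by rewrite e in m'p; case: nmp.
rewrite big_mkcond (bigD1_seq m) ?msupp_uniq //= big1 ?addr0 => [|m' /negPf n].
  by case: ifP => //= _; rewrite ?mcoeff0 // mcoeffZ mcoeffX eqxx mulr1.
by case: ifP => _; rewrite ?mcoeff0 // mcoeffZ mcoeffX n mulr0.
Qed.

End Supports.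

(** * Ideals, monomial ideals and bases of quotients *)

Section Ideals.

Variable K : fieldType.
Implicit Types (p q : {mpoly K[2]}) (m u : 'X_{1..2}) (U V : set 'X_{1..2}).
Implicit Types (I J M : set {mpoly K[2]}).

Section IdealTheory.

Variables (I : set {mpoly K[2]}) (idI : is_ideal I).

Lemma ideal0 : I 0. Proof. by case: idI. Qed.

Lemma idealD p q : I p -> I q -> I (p + q).
Proof. by case: idI => _ h _; apply: h. Qed.

Lemma idealM p q : I q -> I (p * q).
Proof. by case: idI => _ _; apply. Qed.

Lemma idealZ c p : I p -> I (c *: p).
Proof. by rewrite -mul_mpolyC; apply: idealM. Qed.

Lemma idealN p : I p -> I (- p).
Proof. by rewrite -scaleN1r; apply: idealZ. Qed.

Lemma idealB p q : I p -> I q -> I (p - q).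
Proof. by move=> hp hq; apply: idealD => //; apply: idealN. Qed.

Lemma ideal_sum (T : Type) (r : seq T) (P : pred T) (F : T -> {mpoly K[2]}) :
  (forall i, P i -> I (F i)) -> I (\sum_(i <- r | P i) F i).
Proof.
move=> h; apply: (big_ind I) => //; [exact: ideal0|exact: idealD].
Qed.

Lemma reduce_supp U V p :
  (forall m, U m -> exists2 q, supp_in V q & I ('X_[m] - q)) ->
  supp_in U p -> exists2 q, supp_in V q & I (p - q).
Proof.
move=> UV Up; rewrite [p]mpolyE big_seq.
apply: (big_ind (fun p => exists2 q, supp_in V q & I (p - q))).
- by exists 0; [apply: supp_in0|rewrite subr0; apply: ideal0].
- move=> p1 p2 [q1 V1 I1] [q2 V2 I2]; exists (q1 + q2); first exact: supp_inD.
  by rewrite opprD addrACA; apply: idealD.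
move=> m; rewrite mcoeff_msupp => /Up/UV[q Vq Iq].
exists (p@_m *: q); first exact: supp_inZ.
by rewrite -scalerBr; apply: idealZ.
Qed.

End IdealTheory.

(** The coordinates of the B i in terms of B' are independent, because a linear
    relation between them puts a combination of the B i in I. *)
Lemma basis_mod_le (L : set {mpoly K[2]}) I n n'
    (B : 'I_n -> {mpoly K[2]}) (B' : 'I_n' -> {mpoly K[2]}) :
  is_ideal I -> L 0 -> basis_mod L I B -> basis_mod L I B' -> (n <= n')%N.
Proof.
move=> idI L0 [LB hB] [_ hB'].
have /choice[c hc] : forall i, exists c : {ffun 'I_n' -> K}, I (B i - \sum_j c j *: B' j).
  by move=> i; have [c [hc _]] := hB' _ (LB i); exists c.
have := @card_free_le K 'I_n 'I_n' c; rewrite !card_ord; apply=> e he i.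
have [c0 [_ hc0]] := hB _ L0.
have I1 : I (0 - \sum_i ([ffun i => e i] : {ffun 'I_n -> K}) i *: B i).
  rewrite sub0r; apply: idealN => //.
  have -> : \sum_i [ffun i => e i] i *: B i
     = \sum_i e i *: (B i - \sum_j c i j *: B' j).
    rewrite (eq_bigr (fun i => e i *: B i)) => [|j _]; last by rewrite ffunE.
    rewrite [RHS](eq_bigr (fun i => e i *: B i - \sum_j (e i * c i j) *: B' j)); last first.
      move=> j _; rewrite scalerBr scaler_sumr; congr (_ - _).
      by apply: eq_bigr => k _; rewrite scalerA.
    rewrite big_split /= sumrN exchange_big /= [X in _ - X]big1 ?subr0 // => j _.
    by rewrite -scaler_suml he scale0r.
  by apply: ideal_sum => // j _; apply: idealZ.
have I2 : I (0 - \sum_i ([ffun=> 0] : {ffun 'I_n -> K}) i *: B i).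
  rewrite big1 ?subr0; first exact: ideal0.
  by move=> j _; rewrite ffunE scale0r.
by have := hc0 _ I1; rewrite (hc0 _ I2) => /ffunP/(_ i); rewrite !ffunE.
Qed.

Lemma dim_mod_uniq (L : set {mpoly K[2]}) I n n' :
  is_ideal I -> L 0 -> dim_mod L I n -> dim_mod L I n' -> n = n'.
Proof.
move=> idI L0 [B hB] [B' hB']; apply/eqP.
by rewrite eqn_leq (basis_mod_le idI L0 hB hB') (basis_mod_le idI L0 hB' hB).
Qed.

Definition span_mon U : set {mpoly K[2]} := [set p | supp_in U p].

Definition up_closed U := forall m u, U m -> U (u + m)%MM.

Lemma span_mon_ideal U : up_closed U -> is_ideal (span_mon U).
Proof.
move=> upU; split; [exact: supp_in0|exact: supp_inD|].
by move=> r p Up m /mcoeffM_neq0[u [v [-> _ /Up]]]; apply: upU.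
Qed.

Lemma span_mon_inj : injective span_mon.
Proof.
move=> U V e; apply/seteqP; split=> m h.
  have : span_mon U 'X_[m] by apply: supp_inX.
  by rewrite e => /(_ m); apply; rewrite mcoeffX eqxx oner_neq0.
have : span_mon V 'X_[m] by apply: supp_inX.
by rewrite -e => /(_ m); apply; rewrite mcoeffX eqxx oner_neq0.
Qed.

Lemma monomials_span U : monomials (span_mon U) = U.
Proof.
apply/seteqP; split=> m; last exact: supp_inX.
by move/(_ m); apply; rewrite mcoeffX eqxx oner_neq0.
Qed.

(** Thus monomial ideals can be handled as up-closed sets of monomials. *)
Lemma monomial_idealP M :
  monomial_ideal M <-> exists2 U, up_closed U & M = span_mon U.
Proof.
split=> [[G ->]|[U upU ->]]; last first.
  exists U; apply/seteqP; split=> [p Up J [idJ GJ]|p].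
    rewrite [p]mpolyE big_seq; apply: ideal_sum => // m; rewrite mcoeff_msupp => /Up Um.
    by apply: idealZ => //; apply: GJ; exists m.
  apply; split; first exact: span_mon_ideal.
  by move=> _ [m Um <-]; apply: supp_inX.
have idS : is_ideal (smallest (@is_ideal K) [set 'X_[m] | m in G]).
  split=> [J [idJ _]|p q hp hq J hJ|r p hp J hJ]; first exact: ideal0.
    by apply: idealD; [case: hJ|apply: hp|apply: hq].
  by apply: idealM; [case: hJ|apply: hp].
pose U := monomials (smallest (@is_ideal K) [set 'X_[m] | m in G]).
have upU : up_closed U by move=> m u Um; rewrite /U /monomials /= mpolyXD; apply: (idealM idS).
exists U => //; apply/seteqP; split=> p; last first.
  move=> Up; rewrite [p]mpolyE big_seq; apply: ideal_sum => // m.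
  by rewrite mcoeff_msupp => /Up Um; apply: (idealZ idS).
apply; split; first exact: span_mon_ideal.
by move=> _ [m Gm <-]; apply: supp_inX => J [_ GJ]; apply: GJ; exists m.
Qed.

End Ideals.

Section MonomialBases.

Variable K : fieldType.
Implicit Types (p q : {mpoly K[2]}) (m u : 'X_{1..2}) (U V W : set 'X_{1..2}).
Implicit Types (I J M : set {mpoly K[2]}) (s t : seq 'X_{1..2}).

Definition free_mod I U := forall p, I p -> supp_in U p -> p = 0.

Lemma mon_basis_mod (L : set {mpoly K[2]}) I s n : is_ideal I -> uniq s -> size s = n ->
  (forall m, m \in s -> L 'X_[m]) -> free_mod I [set` s] ->
  (forall p, L p -> exists2 q, supp_in [set` s] q & I (p - q)) ->
  basis_mod L I (fun i : 'I_n => 'X_[nth 0%MM s i]).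
Proof.
move=> idI us sn Ls fr sp.
have mem (i : 'I_n) : nth 0%MM s i \in s by rewrite mem_nth ?sn.
split=> [i|p Lp]; first exact: Ls.
have [q sq Iq] := sp p Lp.
exists [ffun i : 'I_n => q@_(nth 0%MM s i)]; split=> [|c Ic].
  rewrite (eq_bigr (fun i : 'I_n => q@_(nth 0%MM s i) *: 'X_[nth 0%MM s i])).
    rewrite -(big_mkord xpredT (fun i => q@_(nth 0%MM s i) *: 'X_[nth 0%MM s i])).
    by rewrite -sn -(big_nth _ xpredT (fun m => q@_m *: 'X_[m])) -mpoly_sumE.
  by move=> i _; rewrite ffunE.
have e : q - \sum_i c i *: 'X_[nth 0%MM s i] = 0.
  apply: fr; last first.
    apply: supp_inB => //; apply: supp_in_sum => i _.
    by apply: supp_inZ; apply: supp_inX; exact: mem.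
  have := idealB idI Ic Iq; rewrite opprB [_ + (q - p)]addrC addrA subrK.
  done.
apply/ffunP => i; rewrite ffunE (subr0_eq e) raddf_sum /= (bigD1 i) //= big1 ?addr0.
  by rewrite mcoeffZ mcoeffX eqxx mulr1.
move=> j ji; rewrite mcoeffZ mcoeffX nth_uniq ?sn //.
by case: eqP => [/val_inj ee|]; [rewrite ee eqxx in ji|rewrite mulr0].
Qed.

(** The exchange inequality of Steinitz; unlike in [basis_mod_le], only a part of a
    basis is compared with a family that spans it. *)
Lemma free_mod_size I s t : is_ideal I -> uniq s -> uniq t -> free_mod I [set` s] ->
  (forall m, m \in s -> exists2 q, supp_in [set` t] q & I ('X_[m] - q)) ->
  (size s <= size t)%N.
Proof.
move=> idI us ut fr sp.
have /choice[q hq] : forall i : 'I_(size s), exists q,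
    supp_in [set` t] q /\ I ('X_[nth 0%MM s i] - q).
  by move=> i; have [|q] := sp (nth 0%MM s i); [rewrite mem_nth|exists q].
have := @card_free_le K 'I_(size s) 'I_(size t) (fun i j => (q i)@_(nth 0%MM t j)).
rewrite !card_ord; apply=> c hc i.
have z : \sum_i c i *: q i = 0.
  apply/mpolyP => m; rewrite mcoeff0 raddf_sum /=; have [mt|/negP nmt] := boolP (m \in t).
    rewrite -[RHS](hc (Ordinal (_ : index m t < size t)%N)) ?index_mem //= => h.
    by apply: eq_bigr => j _; rewrite mcoeffZ nth_index.
  rewrite big1 // => j _; rewrite mcoeffZ; have [hj _] := hq j.
  have [->|/hj //] := eqVneq (q j)@_m 0.
  by rewrite mulr0.
have e : \sum_i c i *: 'X_[nth 0%MM s i] = 0.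
  apply: fr; last first.
    by apply: supp_in_sum => j _; apply: supp_inZ; apply: supp_inX; rewrite /= mem_nth.
  have -> : \sum_i c i *: 'X_[nth 0%MM s i] = \sum_i c i *: ('X_[nth 0%MM s i] - q i).
    rewrite [RHS](eq_bigr (fun i => c i *: 'X_[nth 0%MM s i] - c i *: q i)).
      by rewrite sumrB z subr0.
    by move=> j _; rewrite scalerBr.
  by apply: (ideal_sum idI) => j _; apply: (idealZ idI); case: (hq j).
move/mpolyP/(_ (nth 0%MM s i)): e; rewrite mcoeff0 raddf_sum /= (bigD1 i) //= big1.
  by rewrite mcoeffZ mcoeffX eqxx mulr1 addr0.
move=> j ji; rewrite mcoeffZ mcoeffX nth_uniq //.
by case: eqP => [/val_inj ee|]; [rewrite ee eqxx in ji|rewrite mulr0].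
Qed.

Section Graded.

Variables (a b : nat) (a_gt0 : (0 < a)%N) (b_gt0 : (0 < b)%N).

Definition dmons d : seq 'X_{1..2} :=
  [seq m <- [seq mn x y | x <- iota 0 d.+1, y <- iota 0 d.+1] | wdeg a b m == d].

Lemma mem_dmons d m : (m \in dmons d) = (wdeg a b m == d).
Proof.
rewrite mem_filter; case: eqP => [<-|_]; last by [].
rewrite andTb; apply/allpairsP.
exists (m ord0, m ord_max); split; rewrite -?mnE // mem_iota /wdeg /=; nia.
Qed.

Lemma dmons_uniq d : uniq (dmons d).
Proof.
apply/filter_uniq/allpairs_uniq; [exact: iota_uniq|exact: iota_uniq|].
by case=> [x y] [x' y'] _ _; exact: (@mn_inj (x, y) (x', y')).
Qed.

(** Among monomials of the same degree, one exponent decides. *)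
Lemma wdeg_exp_inj (i : 'I_2) m m' : wdeg a b m = wdeg a b m' -> m i = m' i -> m = m'.
Proof.
rewrite /wdeg; case: (ord2 i) => -> e h; apply: mon_eq => //; move: e; rewrite h; nia.
Qed.

(** Requiring that monomials reduce within their degree makes U a basis of each
    graded piece of S / I, so that U computes its Hilbert function. *)
Definition hbasis I U := free_mod I U /\
  forall m, exists2 q, supp_in [set m' | U m' /\ wdeg a b m' = wdeg a b m] q
                     & I ('X_[m] - q).

Definition degree_count U d := count (fun m => m \in U) (dmons d).

Lemma hbasis_dim I U d : is_ideal I -> hbasis I U ->
  dim_mod [set p | p \is d.-homog for (wdeg a b)] I (degree_count U d).
Proof.
move=> idI [fr sp]; pose s := [seq m <- dmons d | m \in U].
exists (fun i => 'X_[nth 0%MM s i]); apply: mon_basis_mod => //.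
- exact/filter_uniq/dmons_uniq.
- exact: size_filter.
- by move=> m; rewrite mem_filter mem_dmons => /andP[_ /eqP e]; rewrite /= dhomogX; apply/eqP.
- move=> p Ip sp'; apply: fr => //; apply: supp_in_sub sp' => m /=.
  by rewrite mem_filter => /andP[/set_mem].
move=> p /dhomog_mf hp; apply: (@reduce_supp _ _ idI [set m | wdeg a b m = d]).
  move=> m md; have [q sq Iq] := sp m; exists q => //; apply: supp_in_sub sq => m' /= [U' e].
  by rewrite /= mem_filter mem_dmons e md eqxx andbT; exact: mem_set.
by move=> m; rewrite -mcoeff_msupp => /hp.
Qed.

Lemma hbasis_hilbert I U h : is_ideal I -> hbasis I U ->
  (hilbert_function a b I h <-> forall d, degree_count U d = h d).
Proof.
move=> idI hb; split=> [hI d|hU d]; last by rewrite -hU; exact: hbasis_dim.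
by apply: (dim_mod_uniq idI _ (hbasis_dim d idI hb) (hI d)); rewrite /= dhomog0.
Qed.

Lemma span_mon_hbasis W : hbasis (span_mon W) (~` W).
Proof.
split=> [p Wp Wp'|m].
  apply/mpolyP => m; rewrite mcoeff0; apply/eqP/negPn/negP => h.
  by have := Wp' _ h; apply; apply: Wp.
have [Wm|Wm] := pselect (W m).
  by exists 0; [apply: supp_in0|rewrite subr0; apply: supp_inX].
by exists 'X_[m]; [apply: supp_inX|rewrite subrr; apply: supp_in0].
Qed.

(** * Initial ideals for the order by one of the two exponents *)

Section Initial.

Variables (i : 'I_2) (I : set {mpoly K[2]}).
Hypotheses (idI : is_ideal I) (hI : homogeneous a b I).

Definition low m : set 'X_{1..2} :=
  [set m' | wdeg a b m' = wdeg a b m /\ (m' i < m i)%N].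

(** The leading monomials of I: X^m - q has leading monomial m. Stating it as a
    congruence avoids a definition of leading terms. *)
Definition init_mons : set 'X_{1..2} :=
  [set m | exists2 q, supp_in (low m) q & I ('X_[m] - q)].

Lemma init_up : up_closed init_mons.
Proof.
move=> m u [q sq Iq]; exists ('X_[u] * q); last first.
  by rewrite mpolyXD -mulrBr; apply: idealM.
move=> _ /mcoeffXM_neq0[v -> /sq[e lt]]; split; first by rewrite !wdegD e.
by rewrite !mnmDE ltn_add2l.
Qed.

(** Those of the lower monomials that are themselves leading are reduced in
    turn; this terminates because the exponent i decreases. *)
Lemma init_reduce m : init_mons m ->
  exists2 q, supp_in [set m' | ~ init_mons m' /\ wdeg a b m' = wdeg a b m /\ (m' i < m i)%N] q
           & I ('X_[m] - q).
Proof.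
have [n le] := ubnP (m i); elim: n m le => // n IH m le [q sq Iq].
have [|q' sq' Iq'] := @reduce_supp _ _ idI (low m)
    [set m' | ~ init_mons m' /\ wdeg a b m' = wdeg a b m /\ (m' i < m i)%N] q _ sq.
  move=> m' [e lt]; have [im|nim] := pselect (init_mons m').
    have [|q' sq' Iq'] := IH m' _ im; first by apply: leq_trans lt _.
    exists q' => //; apply: supp_in_sub sq' => m'' /= [h [e' lt']].
    by rewrite e' (ltn_trans lt').
  by exists 'X_[m']; [apply: supp_inX|rewrite subrr; apply: ideal0].
by exists q' => //; have := idealD idI Iq Iq'; rewrite addrA subrK.
Qed.

Lemma supp_max p : (exists m, p@_m != 0) ->
  exists2 m, p@_m != 0 & forall m', p@_m' != 0 -> (m' i <= m i)%N.
Proof.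
case=> m0 hm0; pose P n := has (fun m => (m i == n)) (msupp p).
have exP : exists n, P n.
  by exists (m0 i); apply/hasP; exists m0; rewrite ?mcoeff_msupp //=.
have ub n : P n -> (n <= \sum_(m <- msupp p) m i)%N.
  by case/hasP => m mp /eqP <-; rewrite (bigD1_seq m) ?msupp_uniq //= leq_addr.
have [n /hasP[m mp /eqP e] max] := ex_maxnP exP ub.
exists m; first by rewrite -mcoeff_msupp.
move=> m' hm'; rewrite e; apply: max; apply/hasP; exists m' => //.
by rewrite mcoeff_msupp.
Qed.

(** A nonzero element of I can be normalized so that its top monomial is
    congruent to lower ones. *)
Lemma init_free : free_mod I (~` init_mons).
Proof.
move=> p Ip sp; apply/eqP/negPn/negP => /mpoly_neq0[m0 hm0].
pose d := wdeg a b m0; pose p' := pihomog (wdeg a b) d p.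
have Ip' : I p' by apply: hI.
have sp' m : p'@_m != 0 -> ~ init_mons m /\ wdeg a b m = d.
  by rewrite mcoeff_pihomog; case: (wdeg a b m =P d) => [e hm|_ /eqP //]; split=> //; apply: sp.
have : exists m, p'@_m != 0 by exists m0; rewrite mcoeff_pihomog eqxx.
case/supp_max => m hm max.
have [nim md] := sp' m hm; apply: nim.
exists ('X_[m] - (p'@_m)^-1 *: p'); last first.
  by rewrite opprB addrC subrK; apply: idealZ.
move=> m'; rewrite mcoeffB mcoeffX mcoeffZ; have [<-|ne] := eqVneq m m'.
  by rewrite mulVf // subrr eqxx.
rewrite sub0r oppr_eq0 mulf_eq0 negb_or => /andP[_ hm'].
have [_ m'd] := sp' _ hm'; split; first by rewrite m'd.
rewrite ltn_neqAle max // andbT; apply: contraNneq ne => e.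
by apply/eqP; apply: (@wdeg_exp_inj i); rewrite ?m'd.
Qed.

Lemma init_hbasis : hbasis I (~` init_mons).
Proof.
split=> [|m]; first exact: init_free.
have [im|nim] := pselect (init_mons m).
  have [q sq Iq] := init_reduce im; exists q => //.
  by apply: supp_in_sub sq => m' /= [? [? _]].
by exists 'X_[m]; [apply: supp_inX|rewrite subrr; apply: ideal0].
Qed.

(** The monomials outside the initial ideal with exponent below k span modulo I
    all the monomials with exponent below k, as reduction lowers the exponent. *)
Lemma init_greedy U d k : free_mod I U ->
  (count (fun m => (m \in U) && (m i < k)%N) (dmons d)
   <= count (fun m => (m \in ~` init_mons) && (m i < k)%N) (dmons d))%N.
Proof.
move=> fr; rewrite -!size_filter; apply: (free_mod_size idI).
- exact/filter_uniq/dmons_uniq.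
- exact/filter_uniq/dmons_uniq.
- move=> p Ip sp'; apply: fr => //; apply: supp_in_sub sp' => m /=.
  by rewrite mem_filter => /andP[/andP[/set_mem]].
move=> m; rewrite mem_filter mem_dmons => /andP[/andP[_ lt] /eqP md].
have [im|nim] := pselect (init_mons m).
  have [q sq Iq] := init_reduce im; exists q => //.
  apply: supp_in_sub sq => m' /= [h [e lt']].
  by rewrite /= mem_filter mem_dmons e md eqxx (ltn_trans lt') // !andbT; exact: mem_set.
exists 'X_[m]; last by rewrite subrr; apply: ideal0.
by apply: supp_inX; rewrite /= mem_filter mem_dmons md eqxx lt !andbT; exact: mem_set.
Qed.

End Initial.

End Graded.

End MonomialBases.

(** * Comparing sets of monomials degree by degree *)

(** A failure at position j would give the threshold rk (nth x0 s j) at least j + 1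
    members of s above it, but at most j members of t. *)
Lemma decreasing_match (T : eqType) (rk : T -> nat) (s t : seq T) x0 j :
  size s = size t ->
  sorted (fun x y => (rk y <= rk x)%N) s -> sorted (fun x y => (rk y <= rk x)%N) t ->
  (forall k, (count (fun x => (k <= rk x)%N) s <= count (fun x => (k <= rk x)%N) t)%N) ->
  (j < size s)%N -> (rk (nth x0 s j) <= rk (nth x0 t j))%N.
Proof.
move=> st ss ts ct js; rewrite leqNgt; apply/negP => lt.
have tr : transitive (fun x y => (rk y <= rk x)%N).
  by move=> y x z xy yz; apply: leq_trans yz xy.
have rf : reflexive (fun x y => (rk y <= rk x)%N) by [].
have := ct (rk (nth x0 s j)); rewrite leqNgt => /negP[].
apply: (@leq_ltn_trans j).
  rewrite -{1}(cat_take_drop j t) count_cat [X in (_ + X)%N](_ : _ = 0%N).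
    rewrite addn0; apply: leq_trans (count_size _ _) _.
    by rewrite size_take -st js.
  apply/eqP; rewrite -leqn0 leqNgt -has_count; apply/hasP => -[x].
  move=> /(nthP x0)[k]; rewrite size_drop nth_drop => kt <-.
  have jt : (j < size t)%N by rewrite -st.
  have jkt : (j + k < size t)%N by rewrite -ltn_subRL.
  have := sorted_leq_nth tr rf x0 ts j (j + k) jt jkt (leq_addr _ _).
  by move=> h1 h2; have := leq_trans h2 h1; rewrite leqNgt lt.
rewrite -{2}(cat_take_drop j.+1 s) count_cat; apply: leq_trans (leq_addr _ _).
suff /eqP -> : count (fun x => (rk (nth x0 s j) <= rk x)%N) (take j.+1 s) == size (take j.+1 s).
  by rewrite size_takel.
rewrite -all_count; apply/allP => x /(nthP x0)[k]; rewrite size_takel // => kj <-.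
rewrite nth_take //.
by apply: (sorted_leq_nth tr rf x0 ss k j (leq_trans kj js) js).
Qed.

Section Domination.

Variables (K : fieldType) (a b : nat) (a_gt0 : (0 < a)%N) (b_gt0 : (0 < b)%N).
Implicit Types (m : 'X_{1..2}) (U V W : set 'X_{1..2}).

Lemma count_compl W d (P : pred 'X_{1..2}) :
  (count (fun m => (m \in W) && P m) (dmons a b d)
   + count (fun m => (m \in ~` W) && P m) (dmons a b d)
   = count P (dmons a b d))%N.
Proof.
rewrite -count_predUI [X in (_ + X)%N](_ : _ = 0%N) ?addn0; last first.
  apply/eqP; rewrite -leqn0 leqNgt -has_count; apply/hasP => -[m _ /=].
  by rewrite classical_sets.in_setC; case: (m \in W); rewrite ?andbF.
by apply: eq_count => m /=; rewrite classical_sets.in_setC; case: (m \in W); case: (P m).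
Qed.

(** The bijection f matches the members of W and W' of each degree in decreasing
    order of the exponent. The hypotheses bear on the complements, which are bases of
    quotients; as a degree contains finitely many monomials, they amount to inequalities
    between the members. The inverse g serves for the opposite comparison. *)
Lemma dominating_bij (i : 'I_2) W W' :
  (forall d, degree_count a b (~` W) d = degree_count a b (~` W') d) ->
  (forall d k, (count (fun m => (m \in ~` W) && (m i < k)%N) (dmons a b d)
             <= count (fun m => (m \in ~` W') && (m i < k)%N) (dmons a b d))%N) ->
  exists f g, [/\ set_bij W W' f, set_bij W' W g, forall m, W' m -> f (g m) = m &
    forall m, W m -> wdeg a b (f m) = wdeg a b m /\ (m i <= f m i)%N].
Proof.
move=> e le.
pose r m m' := (m' i <= m i)%N.
pose L U d := sort r [seq m <- dmons a b d | m \in U].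
have memL U d m : (m \in L U d) = (m \in U) && (wdeg a b m == d).
  by rewrite mem_sort mem_filter mem_dmons.
have uL U d : uniq (L U d) by rewrite sort_uniq filter_uniq ?dmons_uniq.
have sL d : size (L W d) = size (L W' d).
  have h U : (size (L U d) + degree_count a b (~` U) d = size (dmons a b d))%N.
    rewrite size_sort size_filter -(count_predT (dmons a b d)) -(count_compl U d xpredT).
    by congr (_ + _)%N; apply: eq_count => m; rewrite /= andbT.
  by apply/eqP; rewrite -(eqn_add2r (degree_count a b (~` W) d)) h e h.
have ct d k : (count (fun m => (k <= m i)%N) (L W d)
            <= count (fun m => (k <= m i)%N) (L W' d))%N.
  have h U : (count (fun m => (k <= m i)%N) (L U d)
      + (degree_count a b (~` U) d)
      = count (fun m => (k <= m i)%N) (dmons a b d)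
        + count (fun m => (m \in ~` U) && (m i < k)%N) (dmons a b d))%N.
    rewrite (seq.permP (permEl (perm_sort _ _))) count_filter -(count_compl U d).
    rewrite -addnA; congr (_ + _)%N.
      by apply: eq_count => m /=; rewrite andbC.
    rewrite -count_predUI [X in (_ + X)%N](_ : _ = 0%N) ?addn0; last first.
      apply/eqP; rewrite -leqn0 leqNgt -has_count; apply/hasP => -[m _ /=].
      by rewrite ltnNge; case: (m \in _); case: (_ <= _)%N.
    by apply: eq_count => m /=; rewrite ltnNge; case: (m \in _); case: (_ <= _)%N.
  by have := le d k; have := h W; have := h W'; rewrite e; lia.
have sorted_L U d : sorted (fun m m' : 'X_{1..2} => (m' i <= m i)%N) (L U d).
  by apply: sort_sorted => m m'; apply: leq_total.
pose g U U' m := nth m (L U' (wdeg a b m)) (index m (L U (wdeg a b m))).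
have sLs U U' : (U = W /\ U' = W') \/ (U = W' /\ U' = W) ->
    forall d, size (L U' d) = size (L U d).
  by case=> -[-> ->] d; rewrite sL.
have gP U U' : (U = W /\ U' = W') \/ (U = W' /\ U' = W) -> forall m, U m ->
    [/\ U' (g U U' m), wdeg a b (g U U' m) = wdeg a b m & g U' U (g U U' m) = m].
  move=> UU m Um.
  have lt : (index m (L U (wdeg a b m)) < size (L U' (wdeg a b m)))%N.
    by rewrite (sLs U U') // index_mem memL eqxx mem_set.
  have : g U U' m \in L U' (wdeg a b m) by apply: mem_nth.
  rewrite memL => /andP[/set_mem U'm /eqP ge]; split=> //.
  rewrite {1}/g ge index_uniq //; rewrite (set_nth_default m) ?nth_index //.
    by rewrite memL eqxx mem_set.
  by rewrite -(sLs U U').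
have gB U U' (UU : (U = W /\ U' = W') \/ (U = W' /\ U' = W)) : set_bij U U' (g U U').
  have UU' : (U' = W /\ U = W') \/ (U' = W' /\ U = W) by tauto.
  split=> [m /(gP U U' UU)[]//|m m' /set_mem Um /set_mem Um' /(congr1 (g U' U))|m U'm].
    by have [_ _ ->] := gP U U' UU m Um; have [_ _ ->] := gP U U' UU m' Um'.
  by have [? _ eg] := gP U' U UU' m U'm; exists (g U' U m).
have WW : (W = W /\ W' = W') \/ (W = W' /\ W' = W) by left.
have WW' : (W' = W /\ W = W') \/ (W' = W' /\ W = W) by right.
exists (g W W'), (g W' W); split; [exact: gB|exact: gB|by move=> m /(gP W' W WW')[]|].
move=> m Wm; have [_ -> _] := gP W W' WW m Wm; split=> //.
have lt : (index m (L W (wdeg a b m)) < size (L W (wdeg a b m)))%N.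
  by rewrite index_mem memL eqxx mem_set.
have := @decreasing_match _ (fun m => m i) _ _ m _ (sL _) (sorted_L _ _) (sorted_L _ _) (ct _) lt.
by rewrite nth_index // -index_mem.
Qed.

End Domination.

(** * Lex-most and lex-least ideals as initial ideals *)

Section LexExtremal.

Variables (K : fieldType) (a b : nat) (a_gt0 : (0 < a)%N) (b_gt0 : (0 < b)%N).
Implicit Types (m : 'X_{1..2}) (U V W : set 'X_{1..2}).

Lemma lexle_x m m' : wdeg a b m' = wdeg a b m -> (m ord0 <= m' ord0)%N -> lexle m' m.
Proof. rewrite /wdeg /lexle => e le; nia. Qed.

Lemma lexle_y m m' : wdeg a b m' = wdeg a b m -> (m' ord_max <= m ord_max)%N -> lexle m' m.
Proof. rewrite /wdeg /lexle => e le; nia. Qed.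

Section Ideal.

Variables (I : set {mpoly K[2]}) (W : set 'X_{1..2}) (h : nat -> nat).
Hypotheses (idI : is_ideal I) (hI : homogeneous a b I).
Hypotheses (upW : up_closed W) (WI : hbasis a b I (~` W)).

(** The initial ideal has the Hilbert function of I, which W computes as well. *)
Lemma init_mon_hilb (i : 'I_2) :
  mon_hilb a b h (span_mon (K := K) W) -> mon_hilb a b h (span_mon (K := K) (init_mons a b i I)).
Proof.
have upi := @init_up K a b i I idI.
case=> _ hW; split; first by apply/monomial_idealP; exists (init_mons a b i I).
apply/(hbasis_hilbert a_gt0 b_gt0 _ (span_mon_ideal K upi) (span_mon_hbasis K a b _)) => d.
have /(hbasis_hilbert a_gt0 b_gt0 _ (span_mon_ideal K upW) (span_mon_hbasis K a b _)) <- := hW.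
by apply: (hbasis_hilbert a_gt0 b_gt0 _ idI (init_hbasis a_gt0 b_gt0 i idI hI)).1;
   apply: (hbasis_hilbert a_gt0 b_gt0 _ idI WI).2.
Qed.

Lemma init_bij (i : 'I_2) : exists f g,
  [/\ set_bij W (init_mons a b i I) f, set_bij (init_mons a b i I) W g,
      forall m, init_mons a b i I m -> f (g m) = m &
      forall m, W m -> wdeg a b (f m) = wdeg a b m /\ (m i <= f m i)%N].
Proof.
apply: (dominating_bij a_gt0 b_gt0) => d => [|k].
  by apply: (hbasis_hilbert a_gt0 b_gt0 _ idI WI).1;
     apply: (hbasis_hilbert a_gt0 b_gt0 _ idI (init_hbasis a_gt0 b_gt0 i idI hI)).2.
by apply: init_greedy => //; case: WI.
Qed.

(** W is below the initial ideal in the partial order, and maximal. *)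
Lemma lex_most_init : lex_most a b h (span_mon (K := K) W) -> init_mons a b ord0 I = W.
Proof.
case=> hW max; apply: (@span_mon_inj K); apply: max; first exact: init_mon_hilb.
have [f [g [fb _ _ fP]]] := init_bij ord0; exists f; rewrite !monomials_span.
split=> // m /fP[e le].
by split=> //; apply: lexle_x.
Qed.

(** With y leading the matching goes the other way, and W is minimal. *)
Lemma lex_least_init : lex_least a b h (span_mon (K := K) W) -> init_mons a b ord_max I = W.
Proof.
case=> hW min; apply: (@span_mon_inj K); apply: min; first exact: init_mon_hilb.
have [f [g [_ gb fg fP]]] := init_bij ord_max; exists g; rewrite !monomials_span.
split=> // m im; have [gW _ _] := gb; have [] := fP (g m) (gW m im).
by rewrite fg // => e le; split=> //; apply: lexle_y.
Qed.

End Ideal.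

End LexExtremal.

(** * Signed maximal minors *)

Section SignedMinors.

Variables (R : comNzRingType) (m : nat).

Definition signed_minor (A : 'M[R]_(m.+1, m)) (k : 'I_m.+1) : R :=
  (-1) ^+ k * \det (row' k A).

(** The signed minors are the cofactors of a column v adjoined to A; this form
    of Laplace expansion yields their formal properties. *)
Lemma smin_sum (A : 'M[R]_(m.+1, m)) (v : 'cV_m.+1) :
  \sum_k v k 0 * signed_minor A k = \det (row_mx v A : 'M_(m.+1, 1 + m)).
Proof.
rewrite (expand_det_col _ ord0); apply: eq_bigr => k _; rewrite /signed_minor /cofactor addn0.
have -> : row_mx v A k ord0 = v k 0.
  rewrite -[RHS](row_mxEl v A k 0); congr (row_mx v A k _); exact: val_inj.
rewrite (_ : col' ord0 (row_mx v A) = A) //; apply/matrixP => i j.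
rewrite mxE -[RHS](row_mxEr v A i j); congr (row_mx v A i _); exact: val_inj.
Qed.

Lemma smin_delta (A : 'M[R]_(m.+1, m)) k :
  signed_minor A k = \det (row_mx (delta_mx k 0) A : 'M_(m.+1, 1 + m)).
Proof.
rewrite -smin_sum (bigD1 k) //= big1 => [|l /negPf ne]; rewrite mxE ?eqxx ?mul1r ?addr0 //.
by rewrite ne mul0r.
Qed.

(** Adjoining a column of A to A gives a determinant with two equal columns. *)
Lemma smin_kernel (A : 'M[R]_(m.+1, m)) j : \sum_k A k j * signed_minor A k = 0.
Proof.
have := smin_sum A (col j A); rewrite (eq_bigr (fun k => A k j * signed_minor A k)) => [->|k _];
  last by rewrite mxE.
rewrite -det_tr; apply: (@determinant_alternate _ _ _ (lshift m ord0) (rshift 1 j)) => //.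
move=> k; rewrite [LHS]mxE [RHS]mxE; apply: etrans (row_mxEl _ _ _ _) _.
by apply: etrans _ (esym (row_mxEr _ _ _ _)); rewrite mxE.
Qed.

Lemma smin_row_perm (s : 'S_m.+1) (A : 'M[R]_(m.+1, m)) k :
  signed_minor (row_perm s A) k = (-1) ^+ s * signed_minor A (s k).
Proof.
rewrite !smin_delta -det_perm -det_mulmx -row_permE; congr (\det _).
apply/matrixP => i j; rewrite !mxE; case: splitP => l _; rewrite !mxE //.
by rewrite (inj_eq perm_inj).
Qed.

(** Only the identity permutation contributes: on the first k rows it is forced
    from the top down, on the others from the bottom up. *)
Lemma det_split_trig (k : nat) (M : 'M[R]_m) :
  (forall i j : 'I_m, (i < k)%N -> (i < j)%N -> M i j = 0) ->
  (forall i j : 'I_m, (k <= i)%N -> (j < i)%N -> M i j = 0) ->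
  \det M = \prod_i M i i.
Proof.
move=> lo up; rewrite /determinant (bigD1 1%g) //= odd_perm1 mul1r.
rewrite (eq_bigr (fun i => M i i)) => [|i _]; last by rewrite perm1.
rewrite [X in _ + X]big1 ?addr0 // => s /eqP ns1.
suff [i Mi] : exists i, M i (s i) = 0 by rewrite (bigD1 i) //= Mi mul0r mulr0.
apply: contrapT => nM; apply: ns1.
have low (i : 'I_m) : (i < k)%N -> (s i <= i)%N.
  by move=> ik; rewrite leqNgt; apply/negP => lt; apply: nM; exists i; exact: lo.
have high (i : 'I_m) : (k <= i)%N -> (i <= s i)%N.
  by move=> ki; rewrite leqNgt; apply/negP => lt; apply: nM; exists i; exact: up.
have fix1 n : forall i : 'I_m, (i < n)%N -> (i < k)%N -> s i = i.
  elim: n => // n IH i lt ik; have := low i ik; rewrite leq_eqVlt => /orP[/eqP/val_inj //|si].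
  have := IH (s i) (leq_trans si lt) (ltn_trans si ik) => /perm_inj e.
  by rewrite e ltnn in si.
have fix2 n : forall i : 'I_m, (m - i <= n)%N -> (k <= i)%N -> s i = i.
  elim: n => [|n IH] i lt ki; first by have := ltn_ord i; rewrite -subn_gt0; case: (m - i)%N lt.
  have := high i ki; rewrite leq_eqVlt => /orP[/eqP/val_inj <- //|si].
  have /perm_inj e : s (s i) = s i by apply: IH; lia.
  by rewrite e ltnn in si.
apply/permP => i; rewrite perm1; have [ik|ki] := ltnP i k; first exact: (fix1 i.+1).
exact: (fix2 (m - i)%N).
Qed.

(** Deleting row k leaves the diagonal entries u above it and the entries - v of
    the subdiagonal below it. *)
Lemma smin_bidiag (u v : 'I_m -> R) (A : 'M[R]_(m.+1, m)) k :
  (forall i j, A i j = u j *+ (i == j :> nat) - v j *+ (i == j.+1 :> nat)) ->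
  signed_minor A k = (-1) ^+ m * \prod_(j < m) (if (j < k)%N then u j else v j).
Proof.
move=> hA; rewrite /signed_minor (@det_split_trig k).
- have -> : (-1) ^+ m = (-1) ^+ k * \prod_(j < m) (if (j < k)%N then 1 else -1) :> R.
    rewrite -(big_mkord xpredT (fun j => if (j < k)%N then 1 else -1 : R)).
    have km : (k <= m)%N by rewrite -ltnS.
    rewrite (big_cat_nat (n := k)) //= big_nat big1 ?mul1r => [|j /andP[_ ->] //].
    rewrite big_nat (eq_bigr (fun=> -1)) => [|j /andP[kj _]]; last by rewrite ltnNge kj.
    by rewrite -big_nat prodr_const_nat -exprD subnKC.
  rewrite -mulrA -big_split /=; congr (_ * _); apply: eq_bigr => j _.
  rewrite mxE hA /= /bump leqNgt; case: ifP => jk; rewrite ?add0n ?add1n ?eqxx ?mulN1r ?mul1r.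
    by rewrite ltn_eqF // mulr0n subr0.
  by rewrite gtn_eqF // mulr0n sub0r.
- move=> i j ik ij; rewrite mxE hA /= /bump leqNgt ik add0n (ltn_eqF ij).
  by rewrite ltn_eqF ?mulr0n ?subrr // ltnS ltnW.
move=> i j ki ji; rewrite mxE hA /= /bump ki add1n eqSS (gtn_eqF ji).
by rewrite gtn_eqF ?mulr0n ?subrr // ltnS ltnW.
Qed.

End SignedMinors.

(** * One-parameter families of ideals of maximal minors *)

Lemma mcoeff_sign (R : comNzRingType) (n : nat) (p : {mpoly R[2]}) u :
  ((-1) ^+ n * p)@_u = (-1) ^+ n * p@_u.
Proof.
by rewrite -signr_odd mulr_sign -[in RHS]signr_odd mulr_sign; case: odd; rewrite ?mcoeffN.
Qed.

Section ShiftedHomog.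

Variables (R : idomainType) (a b : nat).
Implicit Types (p q : {mpoly R[2]}).

(** This means homogeneous of degree d - c, without truncated subtraction: for d < c
    it forces p = 0, as is right for the entries of a graded matrix. *)
Definition shomog (c d : nat) p := forall u, p@_u != 0 -> (c + wdeg a b u = d)%N.

Lemma shomogM c d c' d' p q :
  shomog c d p -> shomog c' d' q -> shomog (c + c') (d + d') (p * q).
Proof.
by move=> hp hq _ /mcoeffM_neq0[u [v [-> /hp <- /hq <-]]]; rewrite wdegD addnACA.
Qed.

Lemma shomog1 : shomog 0 0 1.
Proof. by move=> u; rewrite mcoeff1 natb_neq0 => /eqP ->; rewrite wdeg0. Qed.

Lemma shomog_prod (J : finType) (c d : J -> nat) (f : J -> {mpoly R[2]}) :
  (forall j, shomog (c j) (d j) (f j)) ->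
  shomog (\sum_j c j) (\sum_j d j) (\prod_j f j).
Proof.
move=> h; apply: (big_ind3 (fun x y p => shomog x y p)) => //; first exact: shomog1.
by move=> ? ? ? ? ? ?; exact: shomogM.
Qed.

Lemma shomog_det n (c d : 'I_n -> nat) (A : 'M[{mpoly R[2]}]_n) :
  (forall i j, shomog (c i) (d j) (A i j)) ->
  shomog (\sum_i c i) (\sum_j d j) (\det A).
Proof.
move=> hA; apply: (@supp_in_sum _ [set u | (\sum_i c i + wdeg a b u = \sum_j d j)%N]) => s _.
move=> u; rewrite mcoeff_sign mulf_eq0 negb_or => /andP[_ hu] /=.
rewrite [RHS](reindex_inj (@perm_inj _ s)) /=.
by have := shomog_prod (fun i => hA i (s i)) hu.
Qed.

(** Each term of the minor has degree the sum of the Y j minus the sum of the X i for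
    i distinct from k. *)
Lemma smin_homog m (X : 'I_m.+1 -> nat) (Y : 'I_m -> nat)
    (A : 'M[{mpoly R[2]}]_(m.+1, m)) k u :
  (\sum_i X i = \sum_j Y j)%N -> (forall i j, shomog (X i) (Y j) (A i j)) ->
  (signed_minor A k)@_u != 0 -> wdeg a b u = X k.
Proof.
move=> e hA; rewrite /signed_minor mcoeff_sign mulf_eq0 negb_or => /andP[_ hu].
have := @shomog_det _ (fun i => X (lift k i)) Y (row' k A) _ u hu.
rewrite -e (bigD1_ord k) //= => h; apply/(@addnI (\sum_(i < m) X (lift k i))).
by rewrite [RHS]addnC h // => i j; rewrite mxE.
Qed.

End ShiftedHomog.

(** The matrix A has its coefficients in K[t], and [minor_ideal A c] is generated by
    its maximal minors at t = c. *)

Section MinorFamily.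

Variables (K : fieldType) (a b : nat) (a_gt0 : (0 < a)%N) (b_gt0 : (0 < b)%N).
Variables (m : nat) (X : 'I_m.+1 -> nat) (Y : 'I_m -> nat).
Variable A : 'M[{mpoly {poly K}[2]}]_(m.+1, m).
Hypothesis sumXY : (\sum_i X i = \sum_j Y j)%N.
Hypothesis homA : forall i j, shomog a b (X i) (Y j) (A i j).
Implicit Types (c : K) (p q : {mpoly K[2]}) (u v : 'X_{1..2}) (U : set 'X_{1..2}).

Local Notation ev c := (map_mpoly (horner_eval c)).

Lemma mcoeff_ev c (p : {mpoly {poly K}[2]}) u : (ev c p)@_u = (p@_u).[c].
Proof. by rewrite mcoeff_map_mpoly. Qed.

Definition minor_at c k : {mpoly K[2]} := ev c (signed_minor A k).

Definition minor_ideal c : set {mpoly K[2]} :=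
  [set p | exists f : 'I_m.+1 -> {mpoly K[2]}, p = \sum_k f k * minor_at c k].

Lemma minor_kernel c j : \sum_k ev c (A k j) * minor_at c k = 0.
Proof.
have := congr1 (ev c) (smin_kernel A j); rewrite rmorph_sum rmorph0 /= => e; rewrite -[RHS]e.
by apply: eq_bigr => k _; rewrite rmorphM.
Qed.

Lemma minor_homog c k u : (minor_at c k)@_u != 0 -> wdeg a b u = X k.
Proof.
rewrite mcoeff_ev => h; apply: (smin_homog sumXY homA (u := u)).
by apply: contraNneq h => ->; rewrite horner0.
Qed.

Lemma minor_idealP c : is_ideal (minor_ideal c).
Proof.
split.
- by exists (fun=> 0); rewrite big1 // => k _; rewrite mul0r.
- move=> _ _ [f ->] [g ->]; exists (fun k => f k + g k).
  by rewrite -big_split; apply: eq_bigr => k _; rewrite mulrDl.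
move=> r _ [f ->]; exists (fun k => r * f k).
by rewrite big_distrr /=; apply: eq_bigr => k _; rewrite mulrA.
Qed.

Lemma minor_in c k : minor_ideal c (minor_at c k).
Proof.
exists (fun l => (l == k)%:R); rewrite (bigD1 k) //= eqxx mul1r big1 ?addr0 //.
by move=> l /negPf ->; rewrite mul0r.
Qed.

Lemma minor_ideal_homog c : homogeneous a b (minor_ideal c).
Proof.
have idJ := minor_idealP c; move=> d _ [f ->]; rewrite linear_sum.
apply: (ideal_sum idJ) => k _ /=; rewrite [f k]mpolyE mulr_suml linear_sum.
apply: (ideal_sum idJ) => u _ /=; rewrite -scalerAl linearZ /=; apply: (idealZ idJ).
have [e|ne] := eqVneq (wdeg a b u + X k)%N d.
  suff -> : pihomog (wdeg a b) d ('X_[u] * minor_at c k) = 'X_[u] * minor_at c k.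
    exact/(idealM idJ)/minor_in.
  apply/mpolyP => v; rewrite mcoeff_pihomog; case: eqP => // ne.
  apply/esym/eqP/negPn/negP => /mcoeffXM_neq0[w ve /minor_homog hw].
  by apply: ne; rewrite ve /= wdegD hw.
suff -> : pihomog (wdeg a b) d ('X_[u] * minor_at c k) = 0 by apply: (ideal0 idJ).
apply/mpolyP => v; rewrite mcoeff_pihomog mcoeff0; case: eqP => // e.
apply/eqP/negPn/negP => /mcoeffXM_neq0[w ve /minor_homog hw].
by rewrite -e ve /= wdegD hw eqxx in ne.
Qed.

(** A nonzero maximal minor makes the columns linearly independent over S. *)
Lemma minor_inj c k0 : minor_at c k0 != 0 ->
  forall e : 'I_m -> {mpoly K[2]},
    (forall k, \sum_j ev c (A k j) * e j = 0) -> forall j, e j = 0.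
Proof.
move=> nz e he j; pose N := map_mx (ev c) (row' k0 A).
have detN : \det N != 0.
  rewrite det_map_mx; apply: contra_neq nz => z.
  by rewrite /minor_at /signed_minor rmorphM /= z mulr0.
have Ne : N *m (\col_j e j) = 0.
  apply/colP => i; rewrite !mxE -[RHS](he (lift k0 i)).
  by apply: eq_bigr => l _; rewrite !mxE.
have : \adj N *m (N *m (\col_j e j)) = 0 by rewrite Ne mulmx0.
rewrite mulmxA mul_adj_mx mul_scalar_mx => /colP/(_ j); rewrite !mxE => /eqP.
by rewrite mulf_eq0 (negPf detN) => /eqP.
Qed.

End MinorFamily.

(** * The monomials of a degenerate member stay a basis nearby *)

Section Boxes.

Variables (a b : nat) (a_gt0 : (0 < a)%N) (b_gt0 : (0 < b)%N) (D : nat).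

Definition bmon (x : 'I_D * 'I_D) : 'X_{1..2} := mn x.1 x.2.

Lemma bmon_inj : injective bmon.
Proof.
move=> [x y] [x' y'] e; congr (_, _); apply: val_inj.
  by rewrite -[LHS](mn0 x y) -[RHS](mn0 x' y'); congr fun_of_multinom.
by rewrite -[LHS](mn1 x y) -[RHS](mn1 x' y'); congr fun_of_multinom.
Qed.

Lemma bmon_onto u : (wdeg a b u < D)%N -> exists x, bmon x = u.
Proof.
rewrite /wdeg => lt; have h0 : (u ord0 < D)%N by nia.
have h1 : (u ord_max < D)%N by nia.
by exists (Ordinal h0, Ordinal h1); rewrite [RHS]mnE.
Qed.

(** These index a basis of the part of degree less than D of the free graded module
    with generators of degrees X. *)
Definition below m (X : 'I_m -> nat) : pred ('I_m * ('I_D * 'I_D)) :=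
  fun x => (X x.1 + wdeg a b (bmon x.2) < D)%N.

Definition mons_below (U : set 'X_{1..2}) : pred ('I_D * 'I_D) :=
  fun x => (bmon x \in U) && (wdeg a b (bmon x) < D)%N.

End Boxes.

Section MinorBasis.

Variables (K : fieldType) (a b : nat) (a_gt0 : (0 < a)%N) (b_gt0 : (0 < b)%N).
Variables (m : nat) (X : 'I_m.+1 -> nat) (Y : 'I_m -> nat).
Variable A : 'M[{mpoly {poly K}[2]}]_(m.+1, m).
Hypothesis sumXY : (\sum_i X i = \sum_j Y j)%N.
Hypothesis homA : forall i j, shomog a b (X i) (Y j) (A i j).

(** U is the set of monomials of the ideal at t = t0, where up to the factor eps each
    of them is a multiple of a minor. The equation [card_below] says that A
    resolves U as far as dimensions are concerned, in degrees below D1. *)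
Variables (U : set 'X_{1..2}) (D D1 : nat) (t0 eps : K).
Hypothesis U_large : forall u, (D <= wdeg a b u)%N -> U u.
Hypothesis leD : (D + a + b <= D1)%N.
Hypothesis eps0 : eps != 0.
Hypothesis U_t0 : forall u, U u -> exists k v, 'X_[v] * minor_at A t0 k = eps *: 'X_[u].
Hypothesis card_below :
  #|below a b (D := D1) X| = (#|mons_below a b (D := D1) U| + #|below a b (D := D1) Y|)%N.

Local Notation ev c := (map_mpoly (horner_eval c)).
Local Notation J c := (minor_ideal A c).
Local Notation N := {x | mons_below a b (D := D1) U x}.
Local Notation F := {x | below a b (D := D1) X x}.
Local Notation G := {x | below a b (D := D1) Y x}.

Section AtPoint.

Variables (c : K).
Variable kv : N -> 'I_m.+1 * 'X_{1..2}.

Let mon (x : N) := bmon (val x).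
Let gen x : {mpoly K[2]} := 'X_[(kv x).2] * minor_at A c (kv x).1.

(** [gen x] deforms the monomial [mon x] of U. That these deformations have an
    invertible matrix of coefficients on the monomials of U is expressed by
    an inverse B and by the independence of the rows. *)
Variable B : N -> N -> K.
Hypothesis BE : forall x z, \sum_y B x y * (gen y)@_(mon z) = (x == z)%:R.
Hypothesis EB : forall e : N -> K,
  (forall z, \sum_y e y * (gen y)@_(mon z) = 0) -> forall y, e y = 0.
Variable k0 : 'I_m.+1.
Hypothesis k0_neq0 : minor_at A c k0 != 0.

Let idJ := minor_idealP A c.

Lemma gen_in x : J c (gen x).
Proof. exact/(idealM idJ)/minor_in. Qed.

Lemma mon_below x : U (mon x) /\ (wdeg a b (mon x) < D1)%N.
Proof. by have /andP[/set_mem] := valP x. Qed.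

Lemma mon_onto u : U u -> (wdeg a b u < D1)%N -> exists x, mon x = u.
Proof.
move=> Uu ud; have [x xu] := bmon_onto a_gt0 b_gt0 ud.
have hx : mons_below a b (D := D1) U x by rewrite /mons_below xu ud mem_set.
by exists (exist (mons_below a b U) x hx).
Qed.

(** Inverting the matrix gives an element of the ideal whose only monomial in U is u;
    as the ideal is homogeneous, its component in the degree of u will do. *)
Lemma minor_reduce_below u : (wdeg a b u < D1)%N ->
  exists2 q, supp_in [set v | (~` U) v /\ wdeg a b v = wdeg a b u] q & J c ('X_[u] - q).
Proof.
move=> ud; have [Uu|nUu] := pselect (U u); last first.
  by exists 'X_[u]; [apply: supp_inX|rewrite subrr; apply: ideal0].
have [x xu] := mon_onto Uu ud.
pose q := 'X_[u] - \sum_y B x y *: gen y.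
exists (pihomog (wdeg a b) (wdeg a b u) q); last first.
  have -> : 'X_[u] - pihomog (wdeg a b) (wdeg a b u) q =
     pihomog (wdeg a b) (wdeg a b u) ('X_[u] - q).
    by rewrite [RHS]linearB /= pihomogX eqxx.
  apply: (minor_ideal_homog sumXY homA); rewrite /q opprB addrC subrK.
  by apply: (ideal_sum idJ) => y _; apply: (idealZ idJ); apply: gen_in.
move=> v; rewrite mcoeff_pihomog; case: (wdeg a b v =P wdeg a b u) => [vd hv|_ /eqP //].
split=> // Uv; have [z zv] : exists z, mon z = v by apply: mon_onto; rewrite ?vd.
move/negP: hv; apply; rewrite /q mcoeffB mcoeffX raddf_sum /=.
rewrite (eq_bigr (fun y => B x y * (gen y)@_(mon z))) => [|y _]; last by rewrite mcoeffZ zv.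
rewrite BE -xu -zv /mon (inj_eq (@bmon_inj D1)) (inj_eq val_inj).
by rewrite subrr.
Qed.

(** From degree D on, no monomial lies outside U, so that reduction puts the monomials
    of degree between D and D1 into the ideal; as D1 - D >= a + b, higher ones
    are reached by multiplication by x or y. *)
Lemma minor_large u : (D <= wdeg a b u)%N -> J c 'X_[u].
Proof.
have [n le] := ubnP (wdeg a b u); elim: n u le => // n IH u le Du.
have [ud|ud] := ltnP (wdeg a b u) D1.
  have [q sq Jq] := minor_reduce_below ud.
  have q0 : q = 0.
    apply/eqP/negPn/negP => /mpoly_neq0[v /sq[nUv vd]].
    by apply/nUv/U_large; rewrite vd.
  by move: Jq; rewrite q0 subr0.
have step (i : 'I_2) : u i != 0%N -> J c 'X_[u].
  move=> ui; have uE : u = (U_(i) + (u - U_(i)))%MM by rewrite addmC submK // lep1mP.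
  have [g0 gD] : (0 < wdeg a b U_(i)%MM)%N /\ (wdeg a b U_(i)%MM <= a + b)%N.
    by rewrite /wdeg !mnm1E; case: (ord2 i) => -> /=; nia.
  have := wdegD a b U_(i)%MM (u - U_(i))%MM; rewrite -uE => ed.
  by rewrite uE mpolyXD; apply: (idealM idJ); apply: IH; lia.
have [u0|/step//] := eqVneq (u ord0) 0%N; have [u1|/step//] := eqVneq (u ord_max) 0%N.
by move: ud; rewrite /wdeg u0 u1; lia.
Qed.

(** Otherwise there would be too many independent vectors in the space F of
    coefficients of combinations of minors: those expressing the deformed
    monomials of U and the element p of the ideal, which are independent even in S,
    and the multiples of the columns of A, which express 0. *)
Lemma minor_free : free_mod (J c) (~` U).
Proof.
move=> p [f pE] pU; apply/eqP/negPn/negP => p0.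
pose fm (x : F) := bmon (\val x).2; pose gm (x : G) := bmon (\val x).2.
(* The three kinds of vectors, as rows of polynomials. *)
pose vec (z : N + unit + G) (k : 'I_m.+1) : {mpoly K[2]} :=
  match z with
  | inl (inl x) => if k == (kv x).1 then 'X_[(kv x).2] else 0
  | inl (inr _) => f k
  | inr x => ev c (A k (val x).1) * 'X_[gm x]
  end.
have : (#|{: N + unit + G}| <= #|{: F}|)%N; last first.
  by rewrite !card_sum card_unit !card_sig card_below addn1 addSn ltnn.
apply: (@card_free_le K _ _ (fun z (x : F) => (vec z (val x).1)@_(fm x))) => e he.
pose E k := \sum_z e z *: vec z k.
have E0 k u : (X k + wdeg a b u < D1)%N -> (E k)@_u = 0.
  move=> lt; have [|x xu] := @bmon_onto a b a_gt0 b_gt0 D1 u.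
    by apply: leq_ltn_trans lt; rewrite leq_addl.
  have hx : below a b (D := D1) X (k, x) by rewrite /below /= xu.
  rewrite -[RHS](he (exist (below a b X) (k, x) hx)) raddf_sum; apply: eq_bigr => z _ /=.
  by rewrite mcoeffZ /fm /= xu.
pose C j := \sum_(x : G | (val x).1 == j) e (inr x) *: 'X_[gm x] : {mpoly K[2]}.
have EE k : E k = \sum_(x : N) e (inl (inl x)) *: vec (inl (inl x)) k
    + e (inl (inr tt)) *: f k + \sum_j ev c (A k j) * C j.
  rewrite /E big_sumType /= big_sumType /=; congr (_ + _ + _).
    by rewrite (bigD1 tt) //= big1 ?addr0 // => -[].
  rewrite (partition_big (fun x : G => (val x).1) xpredT) //=; apply: eq_bigr => j _.
  rewrite /C mulr_sumr; apply: eq_bigr => x /eqP <-.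
  by rewrite scalerAr.
have EW : \sum_k E k * minor_at A c k
    = \sum_(x : N) e (inl (inl x)) *: gen x + e (inl (inr tt)) *: p.
  rewrite (eq_bigr _ (fun k _ => congr1 (fun z => z * _) (EE k))).
  under eq_bigr do rewrite 2!mulrDl.
  rewrite 2!big_split /= [X in _ + _ + X](_ : _ = 0) ?addr0; last first.
    under eq_bigr do rewrite mulr_suml.
    rewrite exchange_big big1 //= => j _.
    under eq_bigr do rewrite mulrAC.
    by rewrite -mulr_suml (minor_kernel A c) mul0r.
  congr (_ + _); last by rewrite pE scaler_sumr; apply: eq_bigr => k _; rewrite scalerAl.
  under eq_bigr do rewrite mulr_suml.
  rewrite exchange_big /=; apply: eq_bigr => x _.
  rewrite (bigD1 (kv x).1) //= eqxx -scalerAl big1 ?addr0 // => k /negPf ->.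
  by rewrite scaler0 mul0r.
have EW0 u : (wdeg a b u < D1)%N -> (\sum_k E k * minor_at A c k)@_u = 0.
  move=> ud; rewrite raddf_sum big1 //= => k _.
  apply/eqP/negPn/negP => /mcoeffM_neq0[v [w [uE Ev /(minor_homog sumXY homA) wX]]].
  move/eqP: Ev; apply; apply: E0.
  by rewrite addnC -wX -wdegD -uE.
have eN x : e (inl (inl x)) = 0.
  apply: (EB (e := fun x => e (inl (inl x)))) => z.
  have [Uz zd] := mon_below z; have := EW0 _ zd; rewrite EW mcoeffD mcoeffZ.
  have -> : p@_(mon z) = 0 by apply/eqP/negPn/negP => /pU; apply.
  rewrite mulr0 addr0 raddf_sum /= => h; rewrite -[RHS]h.
  by apply: eq_bigr => y _; rewrite mcoeffZ.
have ep : e (inl (inr tt)) = 0.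
  have [u hu] := mpoly_neq0 p0.
  have ud : (wdeg a b u < D1)%N.
    rewrite ltnNge; apply/negP => le; apply: (pU _ hu); apply: U_large; lia.
  have := EW0 _ ud; rewrite EW big1 => [|x _]; last by rewrite eN scale0r.
  by rewrite add0r mcoeffZ => /eqP; rewrite mulf_eq0 (negPf hu) orbF => /eqP.
have EC k : E k = \sum_j ev c (A k j) * C j.
  rewrite EE ep scale0r addr0 big1 ?add0r // => x _.
  by rewrite eN scale0r.
have C0 : forall j, C j = 0.
  apply: (minor_inj k0_neq0) => k; rewrite -EC; apply/mpolyP => u; rewrite mcoeff0.
  have [/E0//|ge] := ltnP (X k + wdeg a b u) D1.
  apply/eqP/negPn/negP; rewrite EC raddf_sum /=; apply/negP/negPn/eqP.
  rewrite big1 // => j _; apply/eqP/negPn/negP => /mcoeffM_neq0[v [w [uE hv hw]]].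
  have Xv : (X k + wdeg a b v = Y j)%N.
    by apply: homA; apply: contraNneq hv => z; rewrite mcoeff_ev z horner0.
  have : [set w | (Y j + wdeg a b w < D1)%N] w.
    apply: (supp_in_sum _ hw) => x /eqP <-; apply: supp_inZ; apply: supp_inX.
    exact: (valP x).
  by rewrite /= -Xv -addnA -wdegD -uE ltnNge ge.
move=> [[x|[]]|x]; [exact: eN|exact: ep|].
have /mpolyP/(_ (gm x)) := C0 (val x).1.
rewrite mcoeff0 raddf_sum (bigD1 x) //= mcoeffZ mcoeffX eqxx mulr1 big1 ?addr0 //.
move=> y /andP[/eqP yx ne]; rewrite mcoeffZ mcoeffX.
case: eqP => [e2|]; last by rewrite mulr0.
case/negP: ne; apply/eqP/val_inj; rewrite [LHS]surjective_pairing [RHS]surjective_pairing yx.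
by rewrite (bmon_inj e2).
Qed.

Lemma minor_hbasis_at : hbasis a b (J c) (~` U).
Proof.
split=> [|u]; first exact: minor_free.
have [/minor_reduce_below //|ge] := ltnP (wdeg a b u) D1.
exists 0; [exact: supp_in0|rewrite subr0; apply: minor_large; lia].
Qed.

End AtPoint.

(** The matrix of the deformed monomials is eps times the identity at t0, so that its
    determinant, a polynomial in t, does not vanish identically. The second
    factor of Q is a coefficient of a minor and keeps the minors from vanishing. *)
Lemma minor_hbasis_generic : exists2 Q : {poly K}, Q.[t0] != 0 &
  forall c, Q.[c] != 0 -> hbasis a b (J c) (~` U).
Proof.
have /choice[kv kvE] : forall x : N, exists kv : 'I_m.+1 * 'X_{1..2},
    'X_[kv.2] * minor_at A t0 kv.1 = eps *: 'X_[bmon (val x)].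
  move=> x; have /andP[/set_mem /U_t0[k [v e]] _] := valP x; by exists (k, v).
have [k0 [e0 hk0]] : exists k0 e0, (minor_at A t0 k0)@_e0 != 0.
  have /U_t0[k0 [v kvv]] : U (mn D 0) by apply: U_large; rewrite wdeg_mn; nia.
  have : ('X_[v] * minor_at A t0 k0)@_(mn D 0) != 0.
    by rewrite kvv mcoeffZ mcoeffX eqxx mulr1.
  by move=> /mcoeffXM_neq0[e0 _ h]; exists k0, e0.
pose M : 'M[{poly K}]_#|{: N}| := \matrix_(i, j)
  ('X_[(kv (enum_val i)).2] * signed_minor A (kv (enum_val i)).1)@_(bmon (val (enum_val j))).
have ME c i j : map_mx (horner_eval c) M i j =
    ('X_[(kv (enum_val i)).2] * minor_at A c (kv (enum_val i)).1)@_(bmon (val (enum_val j))).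
  by rewrite !mxE /= /minor_at -(map_mpolyX (horner_eval c)) -rmorphM mcoeff_ev.
exists (\det M * (signed_minor A k0)@_e0) => [|c].
  rewrite hornerM mulf_neq0 //; last by rewrite -mcoeff_ev.
  rewrite -[_.[t0]]/(horner_eval t0 _) -det_map_mx.
  suff -> : map_mx (horner_eval t0) M = eps%:M by rewrite det_scalar expf_neq0.
  apply/matrixP => i j; rewrite ME kvE mcoeffZ mcoeffX mxE (inj_eq (@bmon_inj D1)).
  by rewrite (inj_eq val_inj) (inj_eq enum_val_inj) mulr_natr.
rewrite hornerM mulf_eq0 negb_or => /andP[dM hc].
rewrite -[_.[c]]/(horner_eval c _) -det_map_mx in dM.
set Mc := map_mx _ M in ME dM; have Mu : Mc \in unitmx by rewrite unitmxE unitfE.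
apply: (minor_hbasis_at (kv := kv)
  (B := fun x y => invmx Mc (enum_rank x) (enum_rank y)) _ _ (k0 := k0)).
- move=> x z; have /matrixP/(_ (enum_rank x) (enum_rank z)) := mulVmx Mu.
  rewrite !mxE (inj_eq enum_rank_inj) => <-.
  rewrite [RHS](reindex (@enum_rank N)) /=; last exact: onW_bij (enum_rank_bij _).
  by apply: eq_bigr => y _; rewrite /Mc ME !enum_rankK.
- move=> e he y; pose r : 'rV_#|{: N}| := \row_i e (enum_val i).
  have rM : r *m Mc = 0.
    apply/rowP => j; rewrite !mxE -[RHS](he (enum_val j)).
    rewrite (reindex (@enum_rank N)) /=; last exact: onW_bij (enum_rank_bij _).
    by apply: eq_bigr => z _; rewrite /Mc ME mxE !enum_rankK.
  have : r = 0 by rewrite -(mulmxK Mu r) rM mul0mx.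
  by move/rowP/(_ (enum_rank y)); rewrite !mxE enum_rankK.
by apply: contraNneq hc => z; rewrite -mcoeff_ev -/(minor_at A c k0) z mcoeff0.
Qed.

End MinorBasis.

(** * Degrees of generators and relations of monomial ideals *)

Lemma sum_count_mem B (s : seq nat) (F : nat -> nat) : all (fun e => (e < B)%N) s ->
  (\sum_(e <- s) F e = \sum_(i < B) count_mem (i : nat) s * F i)%N.
Proof.
elim: s => [|e s IH] /= => [_|/andP[eB sB]].
  by rewrite big_nil big1.
rewrite big_cons (IH sB).
rewrite (eq_bigr (fun i : 'I_B => (e == i) * F i + count_mem (i : nat) s * F i)%N).
  rewrite big_split /=; congr (_ + _)%N.
  rewrite (bigD1 (Ordinal eB)) //= eqxx mul1n big1 ?addn0 // => i ne.
  rewrite (_ : (e == i) = false) //; apply: contraNF ne => /eqP ei.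
  by apply/eqP/val_inj.
by move=> i _; rewrite mulnDl.
Qed.

(** The map sending the counting function of a multiset to the function
    d |-> sum of the P d e is unitriangular, so that the counts are recovered by
    induction on the degree. *)
Lemma perm_of_sums (P : nat -> nat -> nat) B (s t : seq nat) :
  (forall d, (d < B)%N -> P d d = 1%N) -> (forall d e, (d < e)%N -> P d e = 0%N) ->
  all (fun e => (e < B)%N) s -> all (fun e => (e < B)%N) t ->
  (forall d, (d < B)%N -> (\sum_(e <- s) P d e = \sum_(e <- t) P d e)%N) ->
  perm_eq s t.
Proof.
move=> P1 P0 sB tB st.
have h n : forall d, (d < n)%N -> (d < B)%N -> count_mem d s = count_mem d t.
  elim: n => // n IH d dn dB; have := st d dB.
  rewrite (sum_count_mem _ sB) (sum_count_mem _ tB).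
  rewrite (bigD1 (Ordinal dB)) //= [in RHS](bigD1 (Ordinal dB)) //= P1 // !muln1.
  set S := (\sum_(i < B | _) _)%N; set T := (\sum_(i < B | _) _)%N.
  suff -> : S = T by move/addIn.
  apply: eq_bigr => i ne; have [lt|gt] := ltnP i d; first by rewrite IH // (leq_trans lt).
  rewrite P0 ?muln0 // ltn_neqAle gt andbT; apply: contraNneq ne => e.
  by apply/eqP/val_inj.
apply/allP => e _; apply/eqP; have [eB|Be] := ltnP e B; first exact: (h e.+1).
rewrite (count_memPn (_ : e \notin s)); last by apply/negP => /(allP sB); lia.
by rewrite (count_memPn (_ : e \notin t)) //; apply/negP => /(allP tB); lia.
Qed.

Section Counting.

Variables (a b : nat) (a_gt0 : (0 < a)%N) (b_gt0 : (0 < b)%N) (B : nat).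

(** The Hilbert functions of S(-g) and K[x](-g) in degree d; exact for d < B. *)
Definition Pcount d g : nat := (\sum_(j < B) \sum_(i < B) (g + (a * i + b * j) == d))%N.
Definition Qcount d g : nat := (\sum_(i < B) (g + a * i == d))%N.

Lemma Qcount_gt d g : (d < g)%N -> Qcount d g = 0%N.
Proof. by move=> dg; rewrite /Qcount big1 // => i _; case: eqP => //; lia. Qed.

Lemma Pcount_gt d g : (d < g)%N -> Pcount d g = 0%N.
Proof.
move=> dg; rewrite /Pcount big1 // => j _; rewrite big1 // => i _.
by case: eqP => //; lia.
Qed.

Lemma PcountE d g : Pcount d g = (\sum_(0 <= j < B) Qcount d (g + b * j))%N.
Proof.
rewrite big_mkord /Pcount; apply: eq_bigr => j _; apply: eq_bigr => i _.
by congr (nat_of_bool (_ == _)); lia.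
Qed.

(** S splits as K[x] and the multiples of y. *)
Lemma Pcount_rec d g : (d < B)%N -> Pcount d g = (Qcount d g + Pcount d (g + b))%N.
Proof.
move=> dB; have B0 : (0 < B)%N by lia.
rewrite !PcountE big_ltn // muln0 addn0; congr (_ + _)%N.
rewrite big_add1 -{2}(prednK B0) big_nat_recr //= [X in (_ + X)%N]Qcount_gt ?addn0.
  by apply: eq_bigr => j _; rewrite mulnS addnA.
have := leq_pmull B.-1 b_gt0; lia.
Qed.

Lemma Pcount_diag d : (d < B)%N -> Pcount d d = 1%N.
Proof.
move=> dB; rewrite Pcount_rec // Pcount_gt ?addn0; last by lia.
rewrite /Qcount; have B0 : (0 < B)%N by lia.
rewrite (bigD1 (Ordinal B0)) //= muln0 addn0 eqxx big1 // => i ne.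
case: eqP => // e; have i0 : i = 0%N :> nat by nia.
by case/negP: ne; apply/eqP/val_inj.
Qed.

Lemma Pcount_tail d n : (d < B)%N -> (n <= B)%N ->
  Pcount d (b * n) = (\sum_(n <= j < B) Qcount d (b * j))%N.
Proof.
move=> dB; have [k e] : exists k, k = (B - n)%N by exists (B - n)%N.
elim: k n e => [|k IH] n e nB.
  have -> : n = B by lia.
  by rewrite big_geq // Pcount_gt //; have := leq_pmull B b_gt0; lia.
rewrite Pcount_rec // big_ltn; last by lia.
rewrite (_ : b * n + b = b * n.+1)%N; last by rewrite mulnS addnC.
by rewrite IH; lia.
Qed.

End Counting.

Section Staircase.

Variables (a b : nat) (a_gt0 : (0 < a)%N) (b_gt0 : (0 < b)%N) (B : nat).
Variables (U : set 'X_{1..2}) (lam : nat -> nat) (n : nat).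
Hypothesis lamE : forall x y, U (mn x y) <-> (lam y <= x)%N.
Hypothesis lam0 : forall y, (n <= y)%N -> lam y = 0%N.
Hypothesis nB : (n <= B)%N.

(** The generators are the x^(lam j) y^j for j <= n; the relation number j is y times
    generator j = a power of x times generator j + 1. *)
Definition gdeg j := (a * lam j + b * j)%N.
Definition gens := [seq gdeg j | j <- iota 0 n.+1].
Definition rels := [seq (gdeg j + b)%N | j <- iota 0 n].

Definition mcount d : nat :=
  #|[pred x : 'I_B * 'I_B | (bmon x \in U) && (wdeg a b (bmon x) == d)]|.

Lemma mcountE d : (d < B)%N -> mcount d = (\sum_(0 <= y < B) Qcount a B d (gdeg y))%N.
Proof.
move=> dB; rewrite /mcount -sum1_card big_mkcond /=.
rewrite -(pair_bigA _ (fun x y : 'I_B =>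
  if (bmon (x, y) \in U) && (wdeg a b (bmon (x, y)) == d) then 1 else 0)%N) /=.
rewrite exchange_big big_mkord /=; apply: eq_bigr => y _.
rewrite -(big_mkord xpredT (fun x =>
  if (mn x y \in U) && (wdeg a b (mn x y) == d) then 1 else 0)%N).
rewrite /Qcount -(big_mkord xpredT (fun i => nat_of_bool (gdeg y + a * i == d))).
have lamU x : (mn x y \in U) = (lam y <= x)%N.
  by apply/idP/idP => [/set_mem/lamE|/lamE/mem_set].
have [ly|ly] := leqP B (lam y).
  rewrite !big_nat !big1 // => x /andP[_ xB]; rewrite ?lamU /gdeg.
    by case: eqP => //; nia.
  by case: leqP => //; lia.
rewrite (big_cat_nat (n := lam y)) //= 1?ltnW // big_nat big1 ?add0n; last first.
  by move=> x /andP[_ xl]; rewrite lamU leqNgt xl.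
rewrite [RHS](big_cat_nat (n := (B - lam y)%N)) //= ?leq_subr //.
rewrite [X in (_ + X)%N]big_nat [X in (_ + X)%N]big1 ?addn0; last first.
  by move=> x /andP[xl xB]; rewrite /gdeg; case: eqP => //; nia.
rewrite -{1}[lam y]add0n big_addn; apply: eq_bigr => x _.
rewrite lamU leq_addl wdeg_mn /gdeg; case: eqP; case: eqP => //; lia.
Qed.

(** Multiplying generator j by y leads into row j + 1, so that only its multiples
    by powers of x are new: they are the row number j of the staircase. *)
Lemma sum_gens d : (d < B)%N ->
  (\sum_(e <- gens) Pcount a b B d e = mcount d + \sum_(e <- rels) Pcount a b B d e)%N.
Proof.
move=> dB; rewrite mcountE // (big_cat_nat (n := n)) //= /gens -addn1 iotaD map_cat.
rewrite big_cat big_seq1 /rels !big_map /= add0n.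
have iE : iota 0 n = index_iota 0 n by rewrite /index_iota subn0.
have gn : gdeg n = (b * n)%N by rewrite /gdeg lam0 // muln0.
rewrite gn Pcount_tail // addnAC iE; congr (_ + _)%N.
  rewrite [in LHS](eq_bigr (fun j => Qcount a B d (gdeg j) + Pcount a b B d (gdeg j + b))%N).
    by rewrite big_split /=.
  by move=> j _; rewrite Pcount_rec.
by apply: eq_big_nat => j /andP[nj _]; rewrite /gdeg lam0 // muln0.
Qed.

End Staircase.

Section StaircaseCounts.

Variables (a b : nat) (a_gt0 : (0 < a)%N) (b_gt0 : (0 < b)%N) (B : nat).
Implicit Types (U : set 'X_{1..2}).

Lemma staircase_exists U D : up_closed U -> (forall m, (D <= wdeg a b m)%N -> U m) ->
  exists lam : nat -> nat, [/\ forall x y, U (mn x y) <-> (lam y <= x)%N,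
    forall y, (D <= y)%N -> lam y = 0%N & forall y, (lam y.+1 <= lam y)%N].
Proof.
move=> upU UD.
have exU y : exists x, mn x y \in U.
  by exists D; apply/mem_set/UD; rewrite wdeg_mn; have := leq_pmull D a_gt0; lia.
pose lam y := ex_minn (exU y).
have lamE x y : U (mn x y) <-> (lam y <= x)%N.
  rewrite /lam; case: ex_minnP => x0 /set_mem Ux0 min; split=> [/mem_set/min //|le].
  have -> : mn x y = (mn (x - x0) 0 + mn x0 y)%MM by rewrite mnD subnK.
  exact: upU.
exists lam; split=> // y.
  move=> Dy; apply/eqP; rewrite -leqn0 -lamE; apply: UD.
  by rewrite wdeg_mn; have := leq_pmull y b_gt0; lia.
rewrite -lamE; have -> : mn (lam y) y.+1 = (mn 0 1 + mn (lam y) y)%MM by rewrite mnD.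
exact/upU/lamE.
Qed.

Lemma mcount_cnt U d : (d < B)%N ->
  (mcount a b B U d + degree_count a b (~` U) d = size (dmons a b d))%N.
Proof.
move=> dB; rewrite -(count_predT (dmons a b d)) -(count_compl a b U d xpredT).
congr (_ + _)%N; last by apply: eq_count => m; rewrite /= andbT.
rewrite -size_filter /mcount cardE -(size_map (@bmon B)); apply/perm_size/uniq_perm.
- by rewrite (map_inj_uniq (@bmon_inj B)) enum_uniq.
- exact/filter_uniq/dmons_uniq.
move=> m; rewrite mem_filter mem_dmons // andbT; apply/mapP/andP.
  by case=> x; rewrite mem_enum inE => /andP[Ux /eqP xd] ->; rewrite Ux xd eqxx.
case=> Um /eqP md; have [|x xm] := @bmon_onto a b a_gt0 b_gt0 B m; first by rewrite md.
by exists x => //; rewrite mem_enum inE xm Um md eqxx.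
Qed.

Lemma ltn_sum z : nat_of_bool (z < B)%N = (\sum_(d < B) (z == d :> nat))%N.
Proof.
have [zB|Bz] := ltnP z B.
  rewrite (bigD1 (Ordinal zB)) //= eqxx big1 // => i ne.
  by case: eqP => // e; case/negP: ne; apply/eqP/val_inj.
by rewrite big1 // => i _; case: eqP => // e; rewrite e leqNgt ltn_ord in Bz.
Qed.

Lemma card_mons_below U : #|mons_below a b (D := B) U| = (\sum_(d < B) mcount a b B U d)%N.
Proof.
rewrite -sum1_card big_mkcond /=.
rewrite (eq_bigr (fun x => \sum_(d < B) ((bmon x \in U) && (wdeg a b (bmon x) == d))))%N.
  rewrite exchange_big; apply: eq_bigr => d _.
  rewrite /mcount -sum1_card [RHS]big_mkcond; apply: eq_bigr => x _.
  by rewrite !inE /=; case: (_ && _).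
move=> x _; rewrite [x \in _]/(mons_below _ _ _ _) /mons_below.
by case: (bmon x \in U) => /=; [rewrite -ltn_sum; case: ltnP|rewrite big1].
Qed.

Lemma card_below_sum k (X : 'I_k -> nat) :
  #|below a b (D := B) X| = (\sum_(d < B) \sum_i Pcount a b B d (X i))%N.
Proof.
rewrite -sum1_card big_mkcond /= exchange_big /=.
rewrite -(pair_bigA _ (fun i x => if below a b (D := B) X (i, x) then 1 else 0)%N) /=.
apply: eq_bigr => i _.
rewrite (eq_bigr (fun x : 'I_B * 'I_B =>
  \sum_(d < B) (X i + wdeg a b (bmon x) == d)))%N; last first.
  by move=> x _; rewrite -ltn_sum /below /=; case: ifP.
rewrite exchange_big; apply: eq_bigr => d _.
rewrite -(pair_bigA _ (fun x y : 'I_B => nat_of_bool (X i + wdeg a b (bmon (x, y)) == d))) /=.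
by rewrite exchange_big.
Qed.

End StaircaseCounts.

(** * Staircase matrices and the interpolating family *)

Lemma smin_map (R R' : comNzRingType) (f : {rmorphism R -> R'}) m
    (A : 'M[R]_(m.+1, m)) k : f (signed_minor A k) = signed_minor (map_mx f A) k.
Proof.
rewrite /signed_minor rmorphM rmorphXn rmorphN1 -det_map_mx; congr (_ * \det _).
by apply/matrixP => i j; rewrite !mxE.
Qed.

Definition bidiag (R : comNzRingType) m (u v : nat -> R) : 'M[R]_(m.+1, m) :=
  \matrix_(i, j) (u j *+ (i == j :> nat) - v j *+ (i == j.+1 :> nat)).

Lemma smin_bidiagE (R : comNzRingType) m (u v : nat -> R) k :
  signed_minor (bidiag m u v) k = (-1) ^+ m * \prod_(0 <= j < m) (if (j < k)%N then u j else v j).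
Proof.
rewrite big_mkord; apply: (@smin_bidiag _ _ (fun j => u j) (fun j => v j)) => i j.
by rewrite mxE.
Qed.

Section StaircaseMatrix.

Variables (R : idomainType) (lam : nat -> nat) (n : nat).
Hypothesis lam_decr : forall y, (lam y.+1 <= lam y)%N.

Definition xstep j : {mpoly R[2]} := 'X_[mn (lam j - lam j.+1) 0].
Definition ystep : {mpoly R[2]} := 'X_[mn 0 1].

Lemma lam_anti i j : (i <= j)%N -> (lam j <= lam i)%N.
Proof.
move=> /subnK <-; elim: (j - i)%N => // k IH; rewrite addSn.
exact: leq_trans (lam_decr _) IH.
Qed.

Lemma staircase_prod l k : (k <= l)%N ->
  \prod_(0 <= j < l) (if (j < k)%N then ystep else xstep j) = 'X_[mn (lam k - lam l) k].
Proof.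
elim: l k => [|l IH] k.
  rewrite leqn0 => /eqP ->; rewrite big_geq // subnn -mpolyX0; congr 'X_[_].
  by apply: mon_eq; rewrite mnm0E.
rewrite leq_eqVlt => /orP[/eqP ->|kl].
  rewrite big_nat_recr //= ltnSn subnn.
  rewrite (eq_big_nat _ _ (F2 := fun j => if (j < l)%N then ystep else xstep j)).
    by rewrite IH // subnn -mpolyXD mnD addn1.
  by move=> j /andP[_ jl]; rewrite jl (ltn_trans jl).
rewrite big_nat_recr //= ltnNge -ltnS kl /= IH // -mpolyXD mnD addn0; congr 'X_[mn _ _].
by have := lam_decr l; have := lam_anti (i := k) (j := l) kl; lia.
Qed.

(** The relation matrix of a staircase completed by n columns with a single entry 1,
    each of which cancels an additional generator. The two forms put these
    columns last and first, so that the columns of the one form that are relations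
    are completions in the other, and both forms are bidiagonal. *)
Definition stair_below : 'M[{mpoly R[2]}]_((n + n).+1, n + n) :=
  bidiag (n + n) (fun j => if (j < n)%N then ystep else 0)
                 (fun j => if (j < n)%N then xstep j else 1).

Definition stair_above : 'M[{mpoly R[2]}]_((n + n).+1, n + n) :=
  bidiag (n + n) (fun j => if (j < n)%N then 1 else ystep)
                 (fun j => if (j < n)%N then 0 else xstep (j - n)).

Lemma smin_stair_below (k : 'I_(n + n).+1) : lam n = 0%N -> (k <= n)%N ->
  signed_minor stair_below k = (-1) ^+ (n + n) * 'X_[mn (lam k) k].
Proof.
move=> l0 kn; rewrite smin_bidiagE; congr (_ * _).
rewrite (big_cat_nat (n := n)) //= ?leq_addr // [X in _ * X]big_nat.
rewrite [X in _ * X]big1 ?mulr1; last first.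
  by move=> j /andP[nj _]; rewrite ltnNge (leq_trans kn nj) /= ltnNge nj.
have <- : (lam k - lam n)%N = lam k by rewrite l0 subn0.
rewrite -staircase_prod //; apply: eq_big_nat => j /andP[_ ->].
by [].
Qed.

Lemma smin_stair_above (k : 'I_(n + n).+1) l :
  lam n = 0%N -> (l <= n)%N -> k = (n + l)%N :> nat ->
  signed_minor stair_above k = (-1) ^+ (n + n) * 'X_[mn (lam l) l].
Proof.
move=> l0 ln kE; rewrite smin_bidiagE kE; congr (_ * _).
rewrite (big_cat_nat (n := n)) //= ?leq_addr // [X in X * _]big_nat.
rewrite [X in X * _]big1 ?mul1r; last first.
  by move=> j /andP[_ jn]; rewrite (leq_trans jn) ?leq_addr // jn.
have <- : (lam l - lam n)%N = lam l by rewrite l0 subn0.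
rewrite -staircase_prod // -{1}[n]add0n big_addn addnK.
apply: eq_big_nat => j _; rewrite addnC ltn_add2l addnC addnK.
by rewrite [(j + n < n)%N]ltnNge leq_addl.
Qed.

Section Degrees.

Variables (a b : nat) (X Y : nat -> nat).

Lemma shomog_bidiag m (u v : nat -> {mpoly R[2]}) (i : 'I_m.+1) (j : 'I_m) :
  (forall j, (j < m)%N -> shomog a b (X j) (Y j) (u j)) ->
  (forall j, (j < m)%N -> shomog a b (X j.+1) (Y j) (v j)) ->
  shomog a b (X i) (Y j) (bidiag m u v i j).
Proof.
move=> hu hv; rewrite mxE; apply: (@supp_inB _ [set w | (X i + wdeg a b w = Y j)%N]).
  by case: eqP => [->|_]; rewrite ?mulr1n ?mulr0n; [exact: hu|exact: supp_in0].
by case: eqP => [->|_]; rewrite ?mulr1n ?mulr0n; [exact: hv|exact: supp_in0].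
Qed.

Lemma shomogX c d w : (c + wdeg a b w = d)%N -> shomog a b c d ('X_[w] : {mpoly R[2]}).
Proof. by move=> e; apply: supp_inX. Qed.

End Degrees.

End StaircaseMatrix.

Section Interpolation.

Variables (K : fieldType) (a b : nat) (lam lam' : nat -> nat) (n : nat).
Hypothesis lam_decr : forall y, (lam y.+1 <= lam y)%N.
Hypothesis lam'_decr : forall y, (lam' y.+1 <= lam' y)%N.
Hypothesis lam0 : forall y, (n <= y)%N -> lam y = 0%N.

Definition row_degs := gens a b lam n ++ rels a b lam' n.
Definition row_degs' := rels a b lam n ++ gens a b lam' n.
Definition col_degs := rels a b lam n ++ rels a b lam' n.

Lemma size_gens l : size (gens a b l n) = n.+1.
Proof. by rewrite size_map size_iota. Qed.

Lemma size_rels l : size (rels a b l n) = n.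
Proof. by rewrite size_map size_iota. Qed.

Lemma nth_gens l j : (j <= n)%N -> nth 0%N (gens a b l n) j = gdeg a b l j.
Proof. by move=> jn; rewrite (nth_map 0%N) ?size_iota // nth_iota. Qed.

Lemma nth_rels l j : (j < n)%N -> nth 0%N (rels a b l n) j = (gdeg a b l j + b)%N.
Proof. by move=> jn; rewrite (nth_map 0%N) ?size_iota // nth_iota. Qed.

Lemma sumn_gens l : l n = 0%N -> sumn (gens a b l n) = sumn (rels a b l n).
Proof.
move=> l0; rewrite !sumnE !big_map -addn1 iotaD big_cat big_seq1 /= add0n {2}/gdeg l0.
rewrite [in RHS]big_split /= big_const_seq count_predT size_iota iter_addn_0; congr (_ + _)%N.
by rewrite muln0.
Qed.

Lemma size_row_degs : size row_degs = (n + n).+1.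
Proof. by rewrite size_cat size_gens size_rels. Qed.

Lemma size_row_degs' : size row_degs' = (n + n).+1.
Proof. by rewrite size_cat size_gens size_rels addnS. Qed.

Lemma size_col_degs : size col_degs = (n + n)%N.
Proof. by rewrite size_cat !size_rels. Qed.

Lemma xstep_deg l j : (l j.+1 <= l j)%N ->
  (gdeg a b l j.+1 + wdeg a b (mn (l j - l j.+1) 0) = gdeg a b l j + b)%N.
Proof. by rewrite /gdeg wdeg_mn => h; nia. Qed.

Lemma stair_below_homog (R : idomainType) (i : 'I_(n + n).+1) (j : 'I_(n + n)) :
  shomog a b (nth 0%N row_degs i) (nth 0%N col_degs j) (stair_below R lam n i j).
Proof.
apply: (shomog_bidiag (X := nth 0%N row_degs) (Y := nth 0%N col_degs)) => {i j} j jm.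
  rewrite /row_degs /col_degs !nth_cat size_gens size_rels ltnS.
  case: ltnP => jn; last exact: supp_in0.
  rewrite (ltnW jn) nth_gens ?(ltnW jn) // nth_rels //; apply: shomogX.
  by rewrite wdeg_mn muln0 muln1.
rewrite /row_degs /col_degs !nth_cat size_gens size_rels ltnS; case: ltnP => jn.
  by rewrite nth_gens // nth_rels //; apply/shomogX/xstep_deg.
by rewrite subSS -mpolyX0; apply: shomogX; rewrite wdeg0 addn0.
Qed.

Lemma stair_above_homog (R : idomainType) (i : 'I_(n + n).+1) (j : 'I_(n + n)) :
  shomog a b (nth 0%N row_degs' i) (nth 0%N col_degs j) (stair_above R lam' n i j).
Proof.
apply: (shomog_bidiag (X := nth 0%N row_degs') (Y := nth 0%N col_degs)) => {i j} j jm.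
  rewrite /row_degs' /col_degs !nth_cat size_rels; case: ltnP => jn.
    by rewrite -mpolyX0; apply: shomogX; rewrite wdeg0 addn0.
  rewrite nth_gens ?nth_rels; [|lia|lia].
  by apply: shomogX; rewrite wdeg_mn muln0 muln1.
rewrite /row_degs' /col_degs !nth_cat size_rels; case: (ltnP j n) => jn; first exact: supp_in0.
rewrite ltnNge (leqW jn) [~~ true]/= subSn // nth_gens ?nth_rels; [|lia|lia].
exact/shomogX/xstep_deg.
Qed.

Variable s : 'S_(n + n).+1.
Hypothesis sP : forall i : 'I_(n + n).+1, nth 0%N row_degs i = nth 0%N row_degs' (s i).

(** The line through the two completed matrices, the rows of the second being
    permuted by s so that their degrees agree with those of the first. *)
Definition interp : 'M[{mpoly {poly K}[2]}]_((n + n).+1, n + n) :=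
  \matrix_(i, j) ((1 - 'X) *: stair_below {poly K} lam n i j
                  + 'X *: stair_above {poly K} lam' n (s i) j).

Lemma interp_homog (i : 'I_(n + n).+1) (j : 'I_(n + n)) :
  shomog a b (nth 0%N row_degs i) (nth 0%N col_degs j) (interp i j).
Proof.
rewrite mxE; apply: (@supp_inD _
  [set w | (nth 0%N row_degs i + wdeg a b w = nth 0%N col_degs j)%N]).
  by apply: supp_inZ; apply: stair_below_homog.
by apply: supp_inZ; rewrite sP; apply: stair_above_homog.
Qed.

Lemma interp_degs :
  (\sum_(i < (n + n).+1) nth 0%N row_degs i = \sum_(j < n + n) nth 0%N col_degs j)%N.
Proof.
rewrite -[in LHS]size_row_degs -[in RHS]size_col_degs.
rewrite -!(big_mkord xpredT) -!(big_nth 0%N xpredT (fun e => e)) -!sumnE.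
by rewrite !sumn_cat sumn_gens // lam0.
Qed.

Local Notation ev c := (map_mpoly (horner_eval c)).

Lemma ev_stair_below (c : K) i j :
  ev c (stair_below {poly K} lam n i j) = stair_below K lam n i j.
Proof.
by rewrite !mxE rmorphB !rmorphMn /=; case: ltnP => _;
   rewrite ?rmorph0 ?rmorph1 /xstep /ystep ?map_mpolyX.
Qed.

Lemma ev_stair_above (c : K) i j :
  ev c (stair_above {poly K} lam' n i j) = stair_above K lam' n i j.
Proof.
by rewrite !mxE rmorphB !rmorphMn /=; case: ltnP => _;
   rewrite ?rmorph0 ?rmorph1 /xstep /ystep ?map_mpolyX.
Qed.

Lemma ev_interp (c : K) i j : ev c (interp i j) =
  (1 - c) *: stair_below K lam n i j + c *: stair_above K lam' n (s i) j.
Proof.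
rewrite mxE rmorphD /= !map_mpolyZ ev_stair_below ev_stair_above.
by rewrite /= /horner_eval hornerD hornerN hornerC hornerX.
Qed.

Lemma minor_at0 k : minor_at interp 0 k = signed_minor (stair_below K lam n) k.
Proof.
rewrite /minor_at smin_map; congr (signed_minor _ k); apply/matrixP => i j.
by rewrite [LHS]mxE /= ev_interp subr0 scale1r scale0r addr0.
Qed.

Lemma minor_at1 k : minor_at interp 1 k = (-1) ^+ s * signed_minor (stair_above K lam' n) (s k).
Proof.
rewrite /minor_at smin_map -smin_row_perm; congr (signed_minor _ k); apply/matrixP => i j.
by rewrite [LHS]mxE /= ev_interp subrr scale1r scale0r add0r [RHS]mxE.
Qed.

End Interpolation.

Lemma finite_roots (K : fieldType) (q : {poly K}) :
  q != 0 -> finite_set [set z | q.[z] = 0].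
Proof.
move=> q0; apply: contrapT => /(infinite_set_fset (size q))[r rq sz].
have := max_poly_roots q0 (rs := finmap.enum_fset r); rewrite ltnNge sz => nr.
suff : false by []; apply: nr; last exact: finmap.fset_uniq.
by apply/allP => z /rq /= h; apply/eqP.
Qed.

Lemma exists_nonroot (K : fieldType) (q : {poly K}) :
  infinite_set [set: K] -> q != 0 -> exists c, q.[c] != 0.
Proof.
move=> Kinf /finite_roots fin; apply: contrapT => h; apply: Kinf.
apply: sub_finite_set fin => c _ /=; apply: contrapT => /eqP hc; apply: h.
by exists c.
Qed.

Lemma mem_leq_sumn (s : seq nat) e : e \in s -> (e <= sumn s)%N.
Proof. by move=> /perm_to_rem/perm_sumn -> /=; rewrite leq_addr. Qed.

Lemma mulr_sign_scale (R : comNzRingType) n (p : {mpoly R[2]}) :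
  (-1) ^+ n * p = ((-1) ^+ n : R) *: p.
Proof. by rewrite -signr_odd mulr_sign -[in RHS]signr_odd scaler_sign. Qed.

Section CommonIdeal.

Variables (K : fieldType) (a b : nat) (a_gt0 : (0 < a)%N) (b_gt0 : (0 < b)%N).
Hypothesis K_infinite : infinite_set [set: K].

Lemma stair_cover U lam n (w : nat -> {mpoly K[2]}) (eps : K) m :
  (forall x y, U (mn x y) <-> (lam y <= x)%N) -> (forall y, (n <= y)%N -> lam y = 0%N) ->
  (forall l, (l <= n)%N -> w l = eps *: 'X_[mn (lam l) l]) ->
  U m -> exists l v, (l <= n)%N /\ 'X_[v] * w l = eps *: 'X_[m].
Proof.
move=> lamE lam0 hw; rewrite [m]mnE => /lamE le.
pose l := minn (m ord_max) n.
exists l, (mn (m ord0 - lam l) (m ord_max - l)); rewrite /l.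
split; first exact: geq_minr.
rewrite hw ?geq_minr // -scalerAr -mpolyXD mnD subnK.
  by rewrite subnK // geq_minl.
by case: (leqP n (m ord_max)) => // _; rewrite lam0.
Qed.

(** I is a general member of the family of ideals of maximal minors that
    interpolates between the relations of U and those of U'. *)
Lemma common_ideal U U' D : up_closed U -> up_closed U' ->
  (forall m, (D <= wdeg a b m)%N -> U m) -> (forall m, (D <= wdeg a b m)%N -> U' m) ->
  (forall d, degree_count a b (~` U) d = degree_count a b (~` U') d) ->
  exists I : set {mpoly K[2]}, [/\ is_ideal I, homogeneous a b I,
    hbasis a b I (~` U) & hbasis a b I (~` U')].
Proof.
move=> upU upU' UD UD' hc.
have [lam [lamE lam0 lam_decr]] := staircase_exists a_gt0 b_gt0 upU UD.
have [lam' [lamE' lam0' lam_decr']] := staircase_exists a_gt0 b_gt0 upU' UD'.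
pose X := row_degs a b lam lam' D; pose X' := row_degs' a b lam lam' D.
pose Y := col_degs a b lam lam' D.
(* D1 exceeds every degree in the lists, so that counting in degrees below D1
   determines them. *)
pose D1 := (D + a + b + sumn X + sumn X').+1.
have DD1 : (D <= D1)%N by rewrite /D1; lia.
have mc d : (d < D1)%N -> mcount a b D1 U d = mcount a b D1 U' d.
  move=> dD; apply/eqP; rewrite -(eqn_add2r (degree_count a b (~` U) d)) mcount_cnt //.
  by rewrite hc mcount_cnt.
have sX d : (d < D1)%N -> (\sum_(e <- X) Pcount a b D1 d e
    = mcount a b D1 U d + \sum_(e <- Y) Pcount a b D1 d e)%N.
  move=> dD; rewrite /X /row_degs /Y /col_degs !big_cat /=.
  by rewrite (sum_gens a_gt0 b_gt0 lamE) // addnA.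
have sX' d : (d < D1)%N -> (\sum_(e <- X') Pcount a b D1 d e
    = mcount a b D1 U d + \sum_(e <- Y) Pcount a b D1 d e)%N.
  move=> dD; rewrite /X' /row_degs' /Y /col_degs !big_cat /= (sum_gens a_gt0 b_gt0 lamE') //.
  by rewrite mc // addnCA.
have XX' : perm_eq X X'.
  apply: (@perm_of_sums (Pcount a b D1) D1).
  - by move=> d; apply: Pcount_diag.
  - by move=> d e; apply: Pcount_gt.
  - by apply/allP => e /mem_leq_sumn; rewrite /D1; lia.
  - by apply/allP => e /mem_leq_sumn; rewrite /D1; lia.
  by move=> d dD; rewrite sX // sX'.
have sz' : size X' == (D + D).+1 by rewrite size_row_degs'.
have [s sE] := tuple_permP (XX' : perm_eq X (Tuple sz')).
have sP (i : 'I_(D + D).+1) : nth 0%N X i = nth 0%N X' (s i).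
  by rewrite sE (nth_map i) ?size_enum_ord // nth_ord_enum (tnth_nth 0%N).
pose A := interp K lam lam' s.
have homA := @interp_homog K a b lam lam' D lam_decr lam_decr' s sP.
have sumA := @interp_degs a b lam lam' D lam0.
have card V : (forall d, (d < D1)%N -> mcount a b D1 V d = mcount a b D1 U d) ->
    #|below a b (D := D1) (fun i : 'I_(D + D).+1 => nth 0%N X i)| =
    (#|mons_below a b (D := D1) V|
     + #|below a b (D := D1) (fun j : 'I_(D + D) => nth 0%N Y j)|)%N.
  move=> hV; rewrite card_mons_below (card_below_sum a b D1 (fun j : 'I_(D + D) => nth 0%N Y j)).
  rewrite (card_below_sum a b D1 (fun i : 'I_(D + D).+1 => nth 0%N X i)) -big_split /=.
  apply: eq_bigr => d _.
  rewrite hV // -[in LHS](size_row_degs a b lam lam' D).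
  rewrite -[in RHS](size_col_degs a b lam lam' D).
  rewrite -(big_mkord xpredT (fun i => Pcount a b D1 d (nth 0%N X i))).
  rewrite -(big_mkord xpredT (fun i => Pcount a b D1 d (nth 0%N Y i))).
  by rewrite -!(big_nth 0%N xpredT (Pcount a b D1 d)) sX.
have leD1 : (D + a + b <= D1)%N by rewrite /D1; lia.
have l0 := lam0 D (leqnn D); have l0' := lam0' D (leqnn D).
have [Q Q0 hQ] : exists2 Q : {poly K}, Q.[0] != 0 &
    forall c, Q.[c] != 0 -> hbasis a b (minor_ideal A c) (~` U).
  apply: (minor_hbasis_generic a_gt0 b_gt0 sumA homA UD leD1 (eps := (-1) ^+ (D + D))).
  - by rewrite signr_eq0.
  - move=> m Um; pose w l := minor_at A 0 (inord l).
    have [|l [v [lD e]]] := stair_cover (w := w) (eps := (-1) ^+ (D + D)) lamE lam0 _ Um.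
      move=> l lD; have lE : (inord l : 'I_(D + D).+1) = l :> nat by rewrite inordK //; lia.
      by rewrite /w minor_at0 smin_stair_below ?lE // mulr_sign_scale.
    by exists (inord l), v.
  - exact: card.
have [Q' Q0' hQ'] : exists2 Q : {poly K}, Q.[1] != 0 &
    forall c, Q.[c] != 0 -> hbasis a b (minor_ideal A c) (~` U').
  pose eps : K := (-1) ^+ s * (-1) ^+ (D + D).
  apply: (minor_hbasis_generic a_gt0 b_gt0 sumA homA UD' leD1 (eps := eps)).
  - by rewrite mulf_neq0 // signr_eq0.
  - move=> m Um; pose w l := minor_at A 1 ((s^-1)%g (inord (D + l))).
    have [|l [v [lD e]]] := stair_cover (w := w) (eps := eps) lamE' lam0' _ Um.
      move=> l lD; have lE : (inord (D + l) : 'I_(D + D).+1) = (D + l)%N :> nat.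
        by rewrite inordK //; lia.
      rewrite /eps /w minor_at1 permKV (smin_stair_above _ _ _ _ lE) //.
      by rewrite !mulr_sign_scale scalerA.
    by exists ((s^-1)%g (inord (D + l))), v.
  - by apply: card => d /mc.
have [|c] := exists_nonroot K_infinite (q := Q * Q').
  rewrite mulf_neq0 //; first by apply: contraNneq Q0 => ->; rewrite horner0.
  by apply: contraNneq Q0' => ->; rewrite horner0.
rewrite hornerM mulf_eq0 negb_or => /andP[/hQ h /hQ' h'].
exists (minor_ideal A c); split=> //; first exact: minor_idealP.
exact: (minor_ideal_homog sumA homA).
Qed.

End CommonIdeal.

(** * Charts, the torus action and limits of orbits *)

Lemma horner_meval (K : fieldType) n (P : {mpoly K[n]}) (f : 'I_n -> {poly K}) z :
  ((map_mpoly polyC P).@[f]).[z] = P.@[fun j => (f j).[z]].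
Proof.
elim/mpolyind: P => [|c m P _ _ IH]; first by rewrite raddf0 !meval0 horner0.
rewrite raddfD /= !mevalD hornerD IH; congr (_ + _).
rewrite map_mpolyZ /= map_mpolyX !mevalZ !mevalX hornerM hornerC; congr (_ * _).
by rewrite horner_prod; apply: eq_bigr => i _; rewrite horner_exp.
Qed.

Section Charts.

Variables (K : fieldType) (N : nat).
Implicit Types (I J : set {mpoly K[2]}) (B : 'I_N -> 'X_{1..2}) (C : 'X_{1..2} -> 'I_N -> K).

Lemma chart_coordsP B I C : is_ideal I ->
  (forall c : 'I_N -> K, I (\sum_i c i *: 'X_[B i]) -> forall i, c i = 0) ->
  (forall m, I ('X_[m] - \sum_i C m i *: 'X_[B i])) -> chart_coords B I C.
Proof.
move=> idI fr sp; split=> //; split=> // p _.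
pose c0 : {ffun 'I_N -> K} := [ffun i => \sum_(m <- msupp p) p@_m * C m i].
have I0 : I (p - \sum_i c0 i *: 'X_[B i]).
  have -> : p - \sum_i c0 i *: 'X_[B i]
     = \sum_(m <- msupp p) p@_m *: ('X_[m] - \sum_i C m i *: 'X_[B i]).
    under [RHS]eq_bigr do rewrite scalerBr.
    rewrite sumrB -mpolyE; congr (_ - _).
    under [RHS]eq_bigr do rewrite scaler_sumr.
    rewrite exchange_big; apply: eq_bigr => i _; rewrite ffunE scaler_suml.
    by apply: eq_bigr => m _; rewrite scalerA.
  by apply: (ideal_sum idI) => m _; apply: (idealZ idI).
exists c0; split=> // c Ic; apply/ffunP => i; apply/subr0_eq; move: i.
apply: (fr (fun i => c0 i - c i)).
have := idealB idI Ic I0; rewrite opprB addrC addrA subrK.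
by under [in X in _ -> X]eq_bigr do rewrite scalerBl; rewrite sumrB.
Qed.

Lemma chart_free B I C (c : 'I_N -> K) : is_ideal I -> chart_coords B I C ->
  I (\sum_i c i *: 'X_[B i]) -> forall i, c i = 0.
Proof.
move=> idI [[_ uB] _] Ic.
have [c0 [_ hc0]] := uB 0 Logic.I.
move=> i; have e1 := hc0 [ffun i => c i]; have e2 := hc0 [ffun=> 0].
have : [ffun i => c i] = [ffun=> 0] :> {ffun 'I_N -> K}.
  rewrite -e1 ?e2 //.
    rewrite sub0r; apply: idealN => //.
    by rewrite big1 => [|j _]; [exact: ideal0|rewrite ffunE scale0r].
  rewrite sub0r; apply: idealN => //; rewrite (eq_bigr (fun i => c i *: 'X_[B i])) // => j _.
  by rewrite ffunE.
by move/ffunP/(_ i); rewrite !ffunE.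
Qed.

Lemma chart_coords_uniq B I C C' m i : is_ideal I ->
  chart_coords B I C -> I ('X_[m] - \sum_i C' m i *: 'X_[B i]) -> C' m i = C m i.
Proof.
move=> idI hC hC'; apply/subr0_eq; move: i; apply: (chart_free idI hC).
have -> : \sum_i (C' m i - C m i) *: 'X_[B i] =
   ('X_[m] - \sum_i C m i *: 'X_[B i]) - ('X_[m] - \sum_i C' m i *: 'X_[B i]).
  rewrite opprB addrC addrA subrK -sumrB; apply: eq_bigr => i _; exact: scalerBl.
by apply: idealB => //; case: hC.
Qed.

End Charts.

Section StandardChart.

Variables (K : fieldType) (a b : nat) (a_gt0 : (0 < a)%N) (b_gt0 : (0 < b)%N).
Variables (N D : nat) (U : set 'X_{1..2}).
Hypothesis UD : forall m, (D <= wdeg a b m)%N -> U m.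
Hypothesis UN : (\sum_(d < D) degree_count a b (~` U) d = N)%N.

Lemma in_mons_below (V : set 'X_{1..2}) x :
  (x \in mons_below a b (D := D) V) = (bmon x \in V) && (wdeg a b (bmon x) < D)%N.
Proof. by []. Qed.

Definition std_seq : seq 'X_{1..2} :=
  [seq bmon x | x <- enum (mons_below a b (D := D) (~` U))].

Definition std_mon (i : 'I_N) : 'X_{1..2} := nth 0%MM std_seq i.

Lemma mem_std_seq m : (m \in std_seq) = (m \in ~` U).
Proof.
apply/mapP/idP => [[x]|Um].
  by rewrite mem_enum in_mons_below => /andP[Ux _ ->].
have md : (wdeg a b m < D)%N.
  by rewrite ltnNge; apply/negP => /UD; apply: set_mem Um.
have [x xm] := bmon_onto a_gt0 b_gt0 md; exists x => //.
by rewrite mem_enum in_mons_below xm Um md.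
Qed.

Lemma std_seq_uniq : uniq std_seq.
Proof. by rewrite (map_inj_uniq (@bmon_inj D)) enum_uniq. Qed.

Lemma size_std_seq : size std_seq = N.
Proof.
rewrite size_map -cardE card_mons_below -UN; apply: eq_bigr => d _.
apply/eqP; rewrite -(eqn_add2r (degree_count a b (~` ~` U) d)) mcount_cnt //.
rewrite -(count_predT (dmons a b d)) -(count_compl a b (~` U) d xpredT).
by apply/eqP; congr (_ + _)%N; apply: eq_count => m; rewrite /= andbT.
Qed.

Lemma std_basis (I : set {mpoly K[2]}) : is_ideal I -> hbasis a b I (~` U) ->
  basis_mod [set: {mpoly K[2]}] I (fun i => 'X_[std_mon i]).
Proof.
move=> idI [fr sp]; apply: mon_basis_mod => //.
- exact: std_seq_uniq.
- exact: size_std_seq.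
- move=> p Ip ps; apply: fr => //; apply: supp_in_sub ps => m /=.
  by rewrite mem_std_seq => /set_mem.
move=> p _; apply: (@reduce_supp _ _ idI [set: 'X_{1..2}]) => // m _.
have [q sq Iq] := sp m; exists q => //; apply: supp_in_sub sq => m' /= [Um' _].
by rewrite mem_std_seq; apply: mem_set.
Qed.

Lemma std_hilb (I : set {mpoly K[2]}) : is_ideal I -> hbasis a b I (~` U) -> hilb N I.
Proof. by move=> idI hb; split=> //; exists (fun i => 'X_[std_mon i]); apply: std_basis. Qed.

End StandardChart.

Lemma basis_chart (K : fieldType) N (I : set {mpoly K[2]}) (B : 'I_N -> 'X_{1..2}) :
  basis_mod [set: {mpoly K[2]}] I (fun i => 'X_[B i]) -> exists C, chart_coords B I C.
Proof.
move=> hB; have /choice[C hC] : forall m, exists c : 'I_N -> K,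
    I ('X_[m] - \sum_i c i *: 'X_[B i]).
  by move=> m; have [c [hc _]] := hB.2 'X_[m] Logic.I; exists c.
by exists C.
Qed.

Section TorusAction.

Variable K : fieldType.
Implicit Types (s t : K) (p : {mpoly K[2]}) (I J : set {mpoly K[2]}) (m : 'X_{1..2}).

Definition weight s t m : K := s ^+ m ord0 * t ^+ m ord_max.

Lemma weight_neq0 s t m : s != 0 -> t != 0 -> weight s t m != 0.
Proof. by move=> s0 t0; rewrite mulf_neq0 // expf_neq0. Qed.

Local Notation act s t p := (p \mPo [tuple s *: 'X_ord0; t *: 'X_ord_max]).

Lemma actX s t m : act s t 'X_[m] = weight s t m *: 'X_[m].
Proof.
rewrite comp_mpolyX !big_ord_recl big_ord0 mulr1 /= !(tnth_nth 0) /=.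
have -> : lift ord0 ord0 = ord_max :> 'I_2 by apply: val_inj.
by rewrite !exprZn -scalerAl -scalerAr scalerA !mpolyXn -mpolyXD; congr (_ *: 'X_[_]);
   apply: mon_eq; rewrite mnmDE !mulmnE !mnm1E /= ?mul1n ?mul0n ?addn0 ?add0n.
Qed.

Lemma mcoeff_act s t p m : (act s t p)@_m = weight s t m * p@_m.
Proof.
have pm : p@_m = \sum_(u <- msupp p) p@_u * (u == m)%:R.
  by rewrite {1}[p]mpolyE raddf_sum; apply: eq_bigr => u _; rewrite /= mcoeffZ mcoeffX.
rewrite comp_mpolyEX pm raddf_sum mulr_sumr; apply: eq_bigr => u _ /=.
rewrite actX !mcoeffZ mcoeffX.
by case: eqP => [->|_]; rewrite ?mulr0 // !mulr1 mulrC.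
Qed.

Lemma torus_act_ideal s t I : is_ideal I -> is_ideal (torus_act s t I).
Proof.
move=> idI; split=> [|p q|r p]; rewrite /torus_act /=.
- by rewrite raddf0; apply: ideal0.
- by rewrite raddfD; apply: idealD.
by rewrite rmorphM; apply: idealM.
Qed.

(** In a chart the torus scales each coordinate by a character. *)
Lemma chart_act N (B : 'I_N -> 'X_{1..2}) I C s t : is_ideal I -> s != 0 -> t != 0 ->
  chart_coords B I C ->
  chart_coords B (torus_act s t I) (fun m i => C m i * weight s t m / weight s t (B i)).
Proof.
move=> idI s0 t0 hC; apply: (chart_coordsP (torus_act_ideal s t idI)) => [c Ic i|m].
  have : I (\sum_i (c i * weight s t (B i)) *: 'X_[B i]).
    move: Ic; rewrite /torus_act /= raddf_sum /=.
    by under eq_bigr do rewrite comp_mpolyZ actX scalerA.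
  move=> /(chart_free idI hC)/(_ i)/eqP.
  by rewrite mulf_eq0 (negPf (weight_neq0 _ s0 t0)) orbF => /eqP.
rewrite /torus_act /= comp_mpolyB actX (raddf_sum (comp_mpoly _)) /=.
have -> : weight s t m *: 'X_[m]
   - \sum_(i < N) ((C m i * weight s t m / weight s t (B i)) *: 'X_[B i]
                   \mPo [tuple s *: 'X_ord0; t *: 'X_ord_max])
   = weight s t m *: ('X_[m] - \sum_i C m i *: 'X_[B i]).
  rewrite scalerBr scaler_sumr; congr (_ - _); apply: eq_bigr => i _.
  by rewrite comp_mpolyZ actX !scalerA divfK ?weight_neq0 // mulrC.
by apply: idealZ => //; case: hC.
Qed.

Lemma torus_act_hilb N I s t (B : 'I_N -> 'X_{1..2}) C : is_ideal I -> chart_coords B I C ->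
  s != 0 -> t != 0 -> hilb N (torus_act s t I).
Proof.
move=> idI hC s0 t0; split; first exact: torus_act_ideal.
by exists (fun i => 'X_[B i]); case: (chart_act idI s0 t0 hC).
Qed.

Lemma monomial_torus_fixed I : monomial_ideal I -> torus_fixed I.
Proof.
case/monomial_idealP => U _ -> s t s0 t0; apply/seteqP.
by split=> p h m hm; apply: h; move: hm; rewrite mcoeff_act mulf_eq0 negb_or weight_neq0.
Qed.

(** J is the limit at z = 0 under the one-parameter subgroup that scales the variable k
    by z: coordinates of positive weight tend to 0, those of weight 0 are
    constant. An equation of a closed set containing the orbit becomes a polynomial in
    z that vanishes for all z != 0, hence at 0. *)
Lemma torus_limit N (B : 'I_N -> 'X_{1..2}) (k : 'I_2) I J C C0 :
  infinite_set [set: K] -> is_ideal I -> chart_coords B I C ->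
  (forall m i, C m i != 0 -> (B i k <= m k)%N) ->
  hilb N J -> chart_coords B J C0 ->
  (forall m i, C0 m i = if m k == B i k then C m i else 0) ->
  zariski_closure N (torus_orbit I) J.
Proof.
move=> Kinf idI hC Cw hJ hC0 C0E Z [[Zh Zc] ZI].
have [E Ef ZE] := Zc B; apply/(ZE J C0 hJ hC0) => F EF.
have [n [v [P FE]]] := Ef F EF.
pose f j : {poly K} := (C (v j).1 (v j).2)%:P * 'X^((v j).1 k - B (v j).2 k).
pose q := (map_mpoly polyC P).@[f].
have q0 : q = 0.
  (* The factor 'X excludes the value 0. *)
  apply/eqP/negPn/negP => qn; have [|z] := exists_nonroot Kinf (q := 'X * q).
    by rewrite mulf_neq0 // polyX_eq0.
  rewrite hornerM hornerX mulf_eq0 negb_or => /andP[z0]; move/negP; apply; apply/eqP.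
  pose s := if k == ord0 then z else 1; pose t := if k == ord0 then 1 else z.
  have s0 : s != 0 by rewrite /s; case: ifP; rewrite ?oner_eq0.
  have t0 : t != 0 by rewrite /t; case: ifP; rewrite ?oner_eq0.
  have wE m : weight s t m = z ^+ m k.
    rewrite /weight /s /t; case: (ord2 k) => -> /=; rewrite expr1n ?mulr1 ?mul1r //.
  have hz := torus_act_hilb idI hC s0 t0.
  have Zz : Z (torus_act s t I) by apply: ZI; exists s, t.
  have := (ZE _ _ hz (chart_act idI s0 t0 hC)).1 Zz F EF.
  rewrite FE /q horner_meval => <-; apply: meval_eq => j.
  rewrite /f hornerM hornerC hornerXn !wE; set m := (v j).1; set i := (v j).2.
  have [->|/Cw le] := eqVneq (C m i) 0; first by rewrite !mul0r.
  by rewrite -mulrA expfB_cond // (negPf z0) add0n.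
have : q.[0] = 0 by rewrite q0 horner0.
rewrite FE /q horner_meval => <-; apply: meval_eq => j.
rewrite /f hornerM hornerC hornerXn C0E; set m := (v j).1; set i := (v j).2.
have [->|/Cw le] := eqVneq (C m i) 0; first by rewrite if_same mul0r.
by rewrite expr0n subn_eq0 eqn_leq le andbT; case: (_ <= _)%N; rewrite ?mulr1 ?mulr0.
Qed.

End TorusAction.

Section LimitInit.

Variables (K : fieldType) (a b : nat) (a_gt0 : (0 < a)%N) (b_gt0 : (0 < b)%N).
Hypothesis K_infinite : infinite_set [set: K].
Variables (N D : nat) (W : set 'X_{1..2}) (I : set {mpoly K[2]}).
Hypothesis WD : forall m, (D <= wdeg a b m)%N -> W m.
Hypothesis WN : (\sum_(d < D) degree_count a b (~` W) d = N)%N.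
Hypotheses (upW : up_closed W) (idI : is_ideal I) (WI : hbasis a b I (~` W)).

Local Notation B := (@std_mon a b N D W).

Lemma std_sum (q : {mpoly K[2]}) : supp_in (~` W) q -> q = \sum_i q@_(B i) *: 'X_[B i].
Proof.
move=> Wq; rewrite [LHS](@mpoly_sumE _ (std_seq a b D W)) ?std_seq_uniq //; last first.
  by move=> m /Wq Wm /=; rewrite (mem_std_seq a_gt0 b_gt0 WD) mem_set.
rewrite (big_nth 0%MM) (size_std_seq a_gt0 b_gt0 WN).
by rewrite big_mkord.
Qed.

Lemma coords_reduce C m i (q : {mpoly K[2]}) : chart_coords B I C ->
  supp_in (~` W) q -> I ('X_[m] - q) -> C m i = q@_(B i).
Proof.
move=> hC Wq Iq; apply/esym.
by apply: (chart_coords_uniq (C' := fun _ i => q@_(B i)) _ idI hC); rewrite -std_sum.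
Qed.

Lemma coords_graded C m i : chart_coords B I C -> C m i != 0 -> wdeg a b m = wdeg a b (B i).
Proof.
move=> hC; have [q sq Iq] := WI.2 m.
rewrite (coords_reduce _ hC _ Iq) => [/sq[] //|].
by apply: supp_in_sub sq => m' [].
Qed.

(** In the chart of the monomials outside W, a member of W is congruent to monomials
    with a smaller exponent k, so its coordinates have positive weight. *)
Lemma init_limit (k : 'I_2) : init_mons a b k I = W ->
  zariski_closure N (torus_orbit I) (span_mon W).
Proof.
move=> iW; have hB := std_basis a_gt0 b_gt0 WD WN idI WI.
have [C hC] := basis_chart hB.
have idM := span_mon_ideal K upW; have hM := span_mon_hbasis K a b W.
have [C0 hC0] := basis_chart (std_basis a_gt0 b_gt0 WD WN idM hM).
have CW m i : W m -> C m i != 0 -> (B i k < m k)%N.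
  move=> Wm; have : init_mons a b k I m by rewrite iW.
  case/(init_reduce idI) => q sq Iq; rewrite iW in sq.
  rewrite (coords_reduce _ hC _ Iq) => [/sq[_ []] //|].
  by apply: supp_in_sub sq => m' [].
have CX m i : ~ W m -> C m i = (m == B i)%:R.
  move=> Wm; rewrite (coords_reduce (q := 'X_[m]) _ hC) ?mcoeffX //; first exact: supp_inX.
  by rewrite subrr; apply: ideal0.
have C0W m i : W m -> C0 m i = 0.
  move=> Wm; apply/esym; rewrite -[LHS](mcoeff0 K (B i)).
  apply: (chart_coords_uniq (C' := fun _ i => (0 : {mpoly K[2]})@_(B i)) (m := m) _ idM hC0).
  rewrite big1 ?subr0; first exact: supp_inX.
  by move=> j _; rewrite mcoeff0 scale0r.
have C0X m i : ~ W m -> C0 m i = (m == B i)%:R.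
  move=> Wm; apply/esym; rewrite -mcoeffX.
  apply: (chart_coords_uniq (C' := fun _ i => ('X_[m] : {mpoly K[2]})@_(B i)) (m := m) _ idM hC0).
  rewrite -std_sum; last exact: supp_inX.
  by rewrite subrr; apply: supp_in0.
apply: (torus_limit (B := B) (k := k) K_infinite idI hC _ _ hC0).
- move=> m i; have [Wm|Wm] := pselect (W m); first by move=> /(CW _ _ Wm)/ltnW.
  by rewrite CX // natb_neq0 => /eqP ->.
- exact: (std_hilb a_gt0 b_gt0 WD WN idM hM).
move=> m i; have [Wm|Wm] := pselect (W m).
  rewrite C0W //; case: eqP => // e; apply/esym/eqP/negPn/negP => /(CW _ _ Wm).
  by rewrite e ltnn.
by rewrite C0X // CX //; case: eqP => [->|_]; rewrite ?eqxx ?if_same.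
Qed.

End LimitInit.

Section SpineIdeal.

Variables (K : fieldType) (a b : nat) (a_gt0 : (0 < a)%N) (b_gt0 : (0 < b)%N).
Hypothesis K_infinite : infinite_set [set: K].
Variables (N : nat) (h : nat -> nat).
Hypothesis hN : sums_to h N.

(** As h is eventually 0, the monomials of large degree belong to M. *)
Lemma mon_hilbP M : @mon_hilb K a b h M -> exists U D,
  [/\ up_closed U, M = span_mon U, forall m, (D <= wdeg a b m)%N -> U m,
      (\sum_(d < D) degree_count a b (~` U) d = N)%N & forall d, degree_count a b (~` U) d = h d].
Proof.
case=> /monomial_idealP[U upU ->] hU; have [D DN] := hN.
have cU : forall d, degree_count a b (~` U) d = h d.
  exact/(hbasis_hilbert a_gt0 b_gt0 _ (span_mon_ideal K upU) (span_mon_hbasis K a b U)).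
exists U, D; split=> //; last by rewrite -(DN _ (leqnn D)); apply: eq_bigr => d _; exact: cU.
move=> m md; apply: contrapT => Um.
have h0 : h (wdeg a b m) = 0%N.
  have := DN _ (leqW md); rewrite big_ord_recr /= (DN _ md) => e.
  by apply/(@addnI N); rewrite e addn0.
have : has (fun m => m \in ~` U) (dmons a b (wdeg a b m)).
  by apply/hasP; exists m; [rewrite mem_dmons|apply: mem_set].
by rewrite has_count -/(degree_count a b (~` U) (wdeg a b m)) cU h0.
Qed.

Lemma mon_hilb_hilb M : @mon_hilb K a b h M -> hilb N M.
Proof.
move=> /mon_hilbP[U [D [upU -> UD UN _]]].
apply: (std_hilb a_gt0 b_gt0 UD UN); first exact: span_mon_ideal.
exact: span_mon_hbasis.
Qed.

Lemma spine_ideal (Mminus Mplus : set {mpoly K[2]}) :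
  lex_least a b h Mminus -> lex_most a b h Mplus ->
  exists I, [/\ hilb N I, homogeneous a b I, hilbert_function a b I h,
    exists (B : 'I_N -> 'X_{1..2}) C, chart_coords B I C /\
      forall m i, C m i != 0 -> wdeg a b m = wdeg a b (B i) &
    zariski_closure N (torus_orbit I) Mminus /\ zariski_closure N (torus_orbit I) Mplus].
Proof.
move=> lm lp; have [V [D' [upV VE VD VN Vh]]] := mon_hilbP lm.1.
have [U [D [upU UE UD UN Uh]]] := mon_hilbP lp.1.
rewrite VE UE in lm lp *.
have [| | |I [idI hI UI VI]] := common_ideal a_gt0 b_gt0 K_infinite (D := maxn D D') upU upV.
- by move=> m md; apply: UD; apply: leq_trans md; apply: leq_maxl.
- by move=> m md; apply: VD; apply: leq_trans md; apply: leq_maxr.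
- by move=> d; rewrite Uh Vh.
exists I; split=> //.
- exact: (std_hilb a_gt0 b_gt0 UD UN).
- exact/(hbasis_hilbert a_gt0 b_gt0 _ idI UI).
- have [C hC] := basis_chart (std_basis a_gt0 b_gt0 UD UN idI UI).
  exists (@std_mon a b N D U), C; split=> // m i.
  exact: (coords_graded a_gt0 b_gt0 UD UN idI UI hC).
split.
  apply: (@init_limit _ _ _ a_gt0 b_gt0 K_infinite _ _ _ _ VD VN upV idI VI ord_max).
  exact: (lex_least_init a_gt0 b_gt0 idI hI upV VI lm).
apply: (@init_limit _ _ _ a_gt0 b_gt0 K_infinite _ _ _ _ UD UN upU idI UI ord0).
exact: (lex_most_init a_gt0 b_gt0 idI hI upU UI lp).
Qed.

End SpineIdeal.

(** * The dimension of the orbit of a homogeneous ideal *)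

Section ClosedSets.

Variables (K : fieldType) (N : nat).
Implicit Types (I J : set {mpoly K[2]}) (B : 'I_N -> 'X_{1..2}).

(** Modulo I and modulo J, a polynomial has the same normal form. *)
Lemma chart_ideal_sub B I J C : is_ideal I -> is_ideal J ->
  chart_coords B I C -> chart_coords B J C -> I `<=` J.
Proof.
move=> idI idJ hI hJ p Ip.
pose r := \sum_(m <- msupp p) p@_m *: ('X_[m] - \sum_i C m i *: 'X_[B i]).
have rI L : is_ideal L -> chart_coords B L C -> L r.
  by move=> idL [_ hL]; apply: (ideal_sum idL) => m _; apply: (idealZ idL).
pose c i := \sum_(m <- msupp p) p@_m * C m i.
have pr : p - r = \sum_i c i *: 'X_[B i].
  rewrite /r; under eq_bigr do rewrite scalerBr.
  rewrite sumrB -mpolyE opprB addrC subrK.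
  under eq_bigr do rewrite scaler_sumr.
  rewrite exchange_big; apply: eq_bigr => i _; rewrite scaler_suml.
  by apply: eq_bigr => m _; rewrite scalerA.
have c0 := chart_free idI hI (c := c); rewrite -pr in c0.
suff -> : p = r by exact: rI.
apply/subr0_eq; rewrite pr big1 // => i _.
by rewrite c0 ?scale0r //; apply: (idealB idI) => //; apply: rI.
Qed.

Lemma chart_ideal_eq B I J C : is_ideal I -> is_ideal J ->
  chart_coords B I C -> chart_coords B J C -> I = J.
Proof.
move=> idI idJ hI hJ; apply/seteqP.
by split; [apply: (chart_ideal_sub idI idJ hI hJ)|apply: (chart_ideal_sub idJ idI hJ hI)].
Qed.

Lemma hilb_closed : zariski_closed N (@hilb K N).
Proof.
split=> // B; exists classical_sets.set0; first by move=> F [].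
by move=> I C hI _; split.
Qed.

(** In a chart, the product of r factors of the form coordinate minus constant, one for
    each J i, separates a given other point from all the J i. *)
Lemma finite_closed (r : nat) (J : 'I_r -> set {mpoly K[2]}) : (0 < N)%N ->
  (forall i, hilb N (J i)) -> zariski_closed N [set I | exists i, I = J i].
Proof.
move=> N0 hJ; split=> [_ [i ->] //|B].
exists [set F | chart_functions F /\ forall i C, chart_coords B (J i) C -> F C = 0].
  by move=> F [].
move=> I C hI hC; split=> [[i IJ] F [_ hF]|hF]; first by apply: (hF i); rewrite -IJ.
apply: contrapT => nI.
have /choice[w hw] : forall i, exists w : 'X_{1..2} * 'I_N * K,
    C w.1.1 w.1.2 != w.2 /\ forall C', chart_coords B (J i) C' -> C' w.1.1 w.1.2 = w.2.
  move=> i; have idJ : is_ideal (J i) by case: (hJ i).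
  have [[C' hC']|nC] := pselect (exists C', chart_coords B (J i) C'); last first.
    exists (0%MM, Ordinal N0, C 0%MM (Ordinal N0) + 1); split=> [|C' hC'];
      last by case: nC; exists C'.
    by rewrite -subr_eq0 opprD addNKr oppr_eq0 oner_eq0.
  have [m [j ne]] : exists m j, C m j != C' m j.
    apply: contrapT => h; apply: nI; exists i.
    apply: (chart_ideal_eq (C := C') _ _ _ hC') => //; first by case: hI.
    suff -> : C' = C by [].
    apply/funext => m; apply/funext => j; apply: contrapT => /eqP ne; apply: h.
    by exists m, j; rewrite eq_sym.
  exists (m, j, C' m j); split=> // C'' hC''.
  by apply: (chart_coords_uniq _ idJ hC'); case: hC''.
pose F (C : 'X_{1..2} -> 'I_N -> K) := \prod_i (C (w i).1.1 (w i).1.2 - (w i).2).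
have /eqP : F C = 0.
  apply: hF; split.
    exists r, (fun i => (w i).1), (\prod_i ('X_i - (w i).2%:MP)); apply/funext => C'.
    by rewrite rmorph_prod; apply: eq_bigr => i _; rewrite /= mevalB mevalXU mevalC.
  move=> i C' hC'; rewrite /F (bigD1 i) //= (hw i).2 // subrr mul0r //.
rewrite prodf_seq_eq0 => /hasP[i _ /=]; rewrite subr_eq0 => /eqP e.
by have [] := hw i; rewrite e eqxx.
Qed.

Lemma point_closed I : (0 < N)%N -> hilb N I -> zariski_closed N [set I].
Proof.
move=> N0 hI; have -> : [set I] = [set L | exists i : 'I_1, L = (fun=> I) i].
  by apply/seteqP; split=> [L -> |L [_ ->]] //; exists ord0.
exact: finite_closed.
Qed.

End ClosedSets.

(** Laurent polynomials, as functions on the nonzero elements, the denominator z ^+ n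
    being cleared. *)
Definition laurent (K : fieldType) (f : K -> K) :=
  exists n (q : {poly K}), forall z, z != 0 -> f z * z ^+ n = q.[z].

Section Laurent.

Variable K : fieldType.
Implicit Types (f g : K -> K).

Lemma laurentC (c : K) : laurent (fun=> c).
Proof. by exists 0%N, c%:P => z _; rewrite expr0 mulr1 hornerC. Qed.

Lemma laurentD f g : laurent f -> laurent g -> laurent (fun z => f z + g z).
Proof.
move=> [n [p hp]] [k [q hq]]; exists (n + k)%N, (p * 'X^k + q * 'X^n) => z z0.
rewrite hornerD !hornerM !hornerXn -hp // -hq // exprD mulrDl; ring.
Qed.

Lemma laurentM f g : laurent f -> laurent g -> laurent (fun z => f z * g z).
Proof.
move=> [n [p hp]] [k [q hq]]; exists (n + k)%N, (p * q) => z z0.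
by rewrite hornerM -hp // -hq // exprD; ring.
Qed.

Lemma laurentX k : laurent (fun z : K => z ^+ k).
Proof. by exists 0%N, 'X^k => z _; rewrite expr0 mulr1 hornerXn. Qed.

Lemma laurentV k : laurent (fun z : K => z^-1 ^+ k).
Proof. by exists k, 1 => z z0; rewrite exprVn mulVf ?expf_neq0 // hornerC. Qed.

Lemma laurent_prod (T : Type) (r : seq T) (f : T -> K -> K) :
  (forall j, laurent (f j)) -> laurent (fun z => \prod_(j <- r) f j z).
Proof.
move=> hf; elim: r => [|x r IH].
  by under eq_fun do rewrite big_nil; apply: laurentC.
by under eq_fun do rewrite big_cons; apply: laurentM.
Qed.

Lemma laurent_exp f k : laurent f -> laurent (fun z => f z ^+ k).
Proof.
move=> hf; elim: k => [|k IH]; first by under eq_fun do rewrite expr0; apply: laurentC.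
by under eq_fun do rewrite exprS; apply: laurentM.
Qed.

Lemma laurent_meval n (P : {mpoly K[n]}) (f : 'I_n -> K -> K) :
  (forall j, laurent (f j)) -> laurent (fun z => P.@[fun j => f j z]).
Proof.
move=> hf; elim/mpolyind: P => [|c m P _ _ IH].
  by under eq_fun do rewrite meval0; apply: laurentC.
under eq_fun do rewrite mevalD mevalZ mevalX.
apply: laurentD => //; apply: laurentM; first exact: laurentC.
by apply: laurent_prod => j; apply: laurent_exp.
Qed.

End Laurent.

Section OrbitDimension.

Variables (K : fieldType) (a b : nat) (a_gt0 : (0 < a)%N) (b_gt0 : (0 < b)%N).
Hypothesis K_infinite : infinite_set [set: K].
Variables (N : nat) (N_gt0 : (0 < N)%N) (I : set {mpoly K[2]}).
Variables (B : 'I_N -> 'X_{1..2}) (C : 'X_{1..2} -> 'I_N -> K).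
Hypothesis idI : is_ideal I.
Hypothesis hC : chart_coords B I C.
Hypothesis C_graded : forall m i, C m i != 0 -> wdeg a b m = wdeg a b (B i).

Implicit Types (s t z : K) (m : 'X_{1..2}) (Z : set (set {mpoly K[2]})).

(** The character of the torus of which all the characters of degree 0 for the
    grading are powers. *)
Definition chi s t : K := s ^+ (b %/ gcdn a b) / t ^+ (a %/ gcdn a b).

Lemma chi_neq0 s t : s != 0 -> t != 0 -> chi s t != 0.
Proof. by move=> s0 t0; rewrite mulf_neq0 ?invr_neq0 ?expf_neq0. Qed.

(** The difference of the exponents is orthogonal to (a, b), hence a multiple of
    (b, - a) divided by the gcd. *)
Lemma weight_ratio_le m m' : wdeg a b m = wdeg a b m' -> (m' ord0 <= m ord0)%N ->
  exists k, forall s t, s != 0 -> t != 0 -> weight s t m / weight s t m' = chi s t ^+ k.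
Proof.
move=> e le; set g := gcdn a b; have g0 : (0 < g)%N by rewrite gcdn_gt0 a_gt0.
have aE : (a %/ g * g)%N = a by rewrite divnK ?dvdn_gcdl.
have bE : (b %/ g * g)%N = b by rewrite divnK ?dvdn_gcdr.
set a' := (a %/ g)%N in aE *; set b' := (b %/ g)%N in bE *.
have co : coprime b' a'.
  rewrite /coprime -(eqn_pmul2r g0) muln_gcdl bE aE mul1n gcdnC.
  exact: eqxx.
have b'0 : (0 < b')%N by move: b_gt0; rewrite -bE; case: (b').
have le1 : (m ord_max <= m' ord_max)%N by move: e; rewrite /wdeg; nia.
pose x := (m ord0 - m' ord0)%N; pose y := (m' ord_max - m ord_max)%N.
have mx : m ord0 = (x + m' ord0)%N by rewrite /x subnK.
have my : m' ord_max = (y + m ord_max)%N by rewrite /y subnK.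
have xy : (a' * x = b' * y)%N.
  apply/eqP; rewrite -(eqn_pmul2r g0) mulnAC aE mulnAC bE; apply/eqP.
  by move: e; rewrite /wdeg mx my; lia.
have /dvdnP[k xk] : (b' %| x)%N.
  by rewrite -(Gauss_dvdr _ co) xy dvdn_mulr.
have yk : y = (k * a')%N.
  by apply/eqP; rewrite -(eqn_pmul2l b'0) -xy xk; apply/eqP; lia.
exists k => s t s0 t0; rewrite /weight mx my xk yk /chi -/g -/a' -/b' exprMn exprVn -!exprM.
rewrite !exprD [(k * b')%N]mulnC [(k * a')%N]mulnC.
have h1 := expf_neq0 (m' ord0) s0; have h2 := expf_neq0 (m ord_max) t0.
have h3 := expf_neq0 (a' * k) t0.
by field; rewrite h1 h2 h3.
Qed.

Lemma weight_ratio m m' : wdeg a b m = wdeg a b m' ->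
  exists2 f : K -> K, laurent f & forall s t, s != 0 -> t != 0 ->
    weight s t m / weight s t m' = f (chi s t).
Proof.
move=> e; have [le|/ltnW le] := leqP (m' ord0) (m ord0).
  by have [k hk] := weight_ratio_le e le; exists (fun z => z ^+ k) => //; exact: laurentX.
have [k hk] := weight_ratio_le (esym e) le.
exists (fun z => z^-1 ^+ k); first exact: laurentV.
by move=> s t s0 t0; rewrite exprVn -hk // invf_div.
Qed.

Local Notation Cst s t := (fun m i => C m i * weight s t m / weight s t (B i)).

Lemma orbit_coord m i : exists2 f : K -> K, laurent f &
  forall s t, s != 0 -> t != 0 -> Cst s t m i = f (chi s t).
Proof.
have [z|/C_graded/weight_ratio[f lf fE]] := eqVneq (C m i) 0.
  by exists (fun=> 0) => [|s t _ _]; [exact: laurentC|rewrite z !mul0r].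
exists (fun z => C m i * f z); first by apply: laurentM; [exact: laurentC|].
by move=> s t s0 t0; rewrite -mulrA fE.
Qed.

Lemma orbit_eq s t s' t' : s != 0 -> t != 0 -> s' != 0 -> t' != 0 ->
  chi s t = chi s' t' -> torus_act s t I = torus_act s' t' I.
Proof.
move=> s0 t0 s0' t0' e.
have h := chart_act idI s0 t0 hC; have h' := chart_act idI s0' t0' hC.
apply: (chart_ideal_eq (torus_act_ideal _ _ idI) (torus_act_ideal _ _ idI) h).
suff -> : Cst s t = Cst s' t' by [].
apply/funext => m; apply/funext => i; have [f _ fE] := orbit_coord m i.
by rewrite !fE // e.
Qed.

Lemma orbit_hilb J : torus_orbit I J -> hilb N J.
Proof. by move=> [s [t [s0 t0 ->]]]; exact: (torus_act_hilb idI hC). Qed.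

Lemma orbit_self : torus_orbit I I.
Proof.
exists 1, 1; split; rewrite ?oner_eq0 //; apply/seteqP.
have e p : p \mPo [tuple 1 *: 'X_ord0; 1 *: 'X_ord_max] = p :> {mpoly K[2]}.
  by apply/mpolyP => m; rewrite mcoeff_act /weight !expr1n !mul1r.
by split=> p; rewrite /torus_act /= e.
Qed.

(** On the orbit the equations of Z are Laurent polynomials in chi; if one of them is
    not identically 0, its numerator is q. *)
Lemma closed_dichotomy Z : zariski_closed N Z -> torus_orbit I `<=` Z \/
  exists2 q : {poly K}, q != 0 & forall s t, s != 0 -> t != 0 ->
    Z (torus_act s t I) -> q.[chi s t] = 0.
Proof.
move=> [_ /(_ B)[E Ef ZE]].
have FE F : E F -> exists n (q : {poly K}), forall s t, s != 0 -> t != 0 ->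
    F (Cst s t) * chi s t ^+ n = q.[chi s t].
  move=> /Ef[n [v [P ->]]].
  have /choice[f hf] : forall j, exists f : K -> K, laurent f /\
      forall s t, s != 0 -> t != 0 -> Cst s t (v j).1 (v j).2 = f (chi s t).
    by move=> j; have [f ? ?] := orbit_coord (v j).1 (v j).2; exists f.
  have [k [q hq]] := laurent_meval P (fun j => (hf j).1).
  exists k, q => s t s0 t0; rewrite -hq ?chi_neq0 //; congr (_ * _).
  by apply: meval_eq => j; rewrite (hf j).2.
have [[F [n [q [EF q0 hq]]]]|nF] := pselect (exists F n (q : {poly K}), [/\ E F, q != 0 &
    forall s t, s != 0 -> t != 0 -> F (Cst s t) * chi s t ^+ n = q.[chi s t]]).
  right; exists q => // s t s0 t0 Zst; rewrite -hq //.
  have := (ZE _ _ (torus_act_hilb idI hC s0 t0) (chart_act idI s0 t0 hC)).1 Zst F EF.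
  by move=> ->; rewrite mul0r.
left=> _ [s [t [s0 t0 ->]]].
apply/(ZE _ _ (torus_act_hilb idI hC s0 t0) (chart_act idI s0 t0 hC)) => F EF.
have [n [q hq]] := FE F EF; have [q0|qn] := eqVneq q 0; last by case: nF; exists F, n, q.
have /eqP := hq s t s0 t0; rewrite q0 horner0 mulf_eq0 => /orP[/eqP //|].
by rewrite expf_eq0 (negPf (chi_neq0 s0 t0)) andbF.
Qed.

(** chi takes infinitely many values: (s, 1) goes to a positive power of s. *)
Lemma chi_avoid (q : {poly K}) : q != 0 -> exists2 s, s != 0 & q.[chi s 1] != 0.
Proof.
move=> q0; set d := (b %/ gcdn a b)%N.
have d0 : (0 < d)%N by rewrite divn_gt0 ?gcdn_gt0 ?a_gt0 // dvdn_leq ?dvdn_gcdr.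
have [|s] := exists_nonroot K_infinite (q := 'X * (q \Po 'X^d)).
  by rewrite mulf_neq0 ?polyX_eq0 // comp_poly_eq0 // size_polyXn.
rewrite hornerM hornerX mulf_eq0 negb_or horner_comp hornerXn => /andP[s0 hs].
by exists s => //; rewrite /chi expr1n invr1 mulr1.
Qed.

Lemma orbit_irreducible : zariski_irreducible N (torus_orbit I).
Proof.
split; first by exists I; exact: orbit_self.
move=> Z1 Z2 /closed_dichotomy[|[q1 q10 h1]]; first by left.
move=> /closed_dichotomy[|[q2 q20 h2]]; first by right.
move=> ZZ; have [|s s0] := @chi_avoid (q1 * q2); first by rewrite mulf_neq0.
have o0 := oner_neq0 K; case/eqP; rewrite hornerM.
have [|/h1|/h2] := ZZ (torus_act s 1 I); first by exists s, 1.
  by move=> -> //; rewrite mul0r.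
by move=> -> //; rewrite mulr0.
Qed.

(** The middle term of a chain of length 2 is a proper closed subset of the orbit,
    hence finite. Being irreducible, it is a point, and has no room for
    the bottom term of the chain. *)
Lemma orbit_dim_le : ~ krull_dim_ge N (torus_orbit I) 2.
Proof.
case=> Ch [hCh lt].
have [[Z1 cZ1 C1E] irr1] := hCh 1%N isT; have [[Z0 _ C0E] [[J0 J00] _]] := hCh 0%N isT.
have [[Z2 _ C2E] _] := hCh 2 isT.
have [C01 nC01] := lt 0%N isT; have [C12 nC12] := lt 1%N isT.
have [J1 [J1C nJ1]] : exists J1, Ch 1%N J1 /\ ~ Ch 0%N J1.
  by apply: contrapT => h; apply: nC01 => J hJ; apply: contrapT => nJ; apply: h; exists J.
have J1X : torus_orbit I J1 by move: J1C; rewrite C1E => -[].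
have J0X : torus_orbit I J0 by move: J00; rewrite C0E => -[].
have [XZ|[q q0 hq]] := closed_dichotomy cZ1.
  by apply: nC12 => J; rewrite C2E C1E => -[XJ _]; split=> //; apply: XZ.
have [rs rsE] := (@finite_seqP _ _).1 (finite_roots q0).
have rsP z : q.[z] = 0 -> z \in rs.
  by move=> hz; have : [set z | q.[z] = 0] z by []; rewrite rsE.
have J01 : J0 <> J1 by move=> e; apply: nJ1; rewrite -e.
(* Js lists the points other than J1 whose character is a root of q, with J0 as a
   default value where there is none. *)
have /choice[Js hJs] : forall j : 'I_(size rs), exists J, [/\ hilb N J, J <> J1 &
    forall s t, s != 0 -> t != 0 -> chi s t = rs`_j ->
      torus_act s t I <> J1 -> torus_act s t I = J].
  move=> j; have [[s [t [s0 t0 e ne]]]|nst] := pselect (exists s t, [/\ s != 0, t != 0,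
      chi s t = rs`_j & torus_act s t I <> J1]).
    exists (torus_act s t I); split=> //; first by apply: orbit_hilb; exists s, t.
    by move=> s' t' s0' t0' e' _; apply: orbit_eq; rewrite // e e'.
  exists J0; split=> //; first exact: orbit_hilb.
  by move=> s t s0 t0 e ne; case: nst; exists s, t.
have cl1 := point_closed N_gt0 (orbit_hilb J1X).
have cl2 := finite_closed N_gt0 (fun j => let: And3 h _ _ := hJs j in h).
have [|/(_ J0)|/(_ J1 J1C)[j e]] := irr1.2 _ _ cl1 cl2.
- move=> J hJ; have := hJ; rewrite {1}C1E => -[[s [t [s0 t0 JE]]] ZJ].
  have [->|ne] := pselect (J = J1); [by left|right].
  have /rsP rin : q.[chi s t] = 0 by apply: hq => //; rewrite -JE.
  have lti : (index (chi s t) rs < size rs)%N by rewrite index_mem.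
  exists (Ordinal lti); rewrite JE; case: (hJs (Ordinal lti)) => _ _; apply=> //.
    by rewrite nth_index.
  by rewrite -JE.
- by move=> h; apply: J01; apply: h; apply: C01.
by case: (hJs j) => _ ne _; apply: ne; rewrite e.
Qed.

(** The chain consists of the point I and the orbit. *)
Lemma orbit_dim : ~ torus_fixed I -> krull_dim N (torus_orbit I) 1.
Proof.
move=> nfix; split; last exact: orbit_dim_le.
have hI := orbit_hilb orbit_self.
exists (fun i => if i == 0%N then [set I] else torus_orbit I); split.
  case=> [|i] _ /=; last first.
    split; last exact: orbit_irreducible.
    exists (@hilb K N); first exact: hilb_closed.
    by apply/seteqP; split=> [J hJ|J []] //; split=> //; apply: orbit_hilb.
  split.
    exists [set I]; first exact: point_closed.
    by apply/seteqP; split=> [J ->|J []] //; split=> //; exact: orbit_self.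
  split; first by exists I.
  by move=> Z1 Z2 _ _ /(_ I erefl)[h|h]; [left|right] => J ->.
case=> // _ /=; split=> [J ->|h]; first exact: orbit_self.
apply: nfix => s t s0 t0; apply: h; exists s, t; split=> //.
Qed.

End OrbitDimension.

(** * Edges of the spine *)

Lemma fixed_closure (K : fieldType) N (I M : set {mpoly K[2]}) : (0 < N)%N ->
  hilb N I -> torus_fixed I -> zariski_closure N (torus_orbit I) M -> M = I.
Proof.
move=> N0 hI fI cM; have := cM [set I]; apply; split; first exact: point_closed.
by move=> _ [s [t [s0 t0 ->]]]; rewrite fI.
Qed.

(** The two limits are distinct, so that the ideal I between them is not fixed. *)
Lemma spine_edge (K : fieldType) N a b h (Mminus Mplus : set {mpoly K[2]}) :
  infinite_set [set: K] -> (0 < N)%N -> (0 < a)%N -> (0 < b)%N -> sums_to h N ->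
  lex_least a b h Mminus -> lex_most a b h Mplus -> Mminus <> Mplus ->
  [/\ hilb N Mminus /\ torus_fixed Mminus, hilb N Mplus /\ torus_fixed Mplus &
    exists I, [/\ hilb N I, krull_dim N (torus_orbit I) 1,
      zariski_closure N (torus_orbit I) Mminus & zariski_closure N (torus_orbit I) Mplus]].
Proof.
move=> Kinf N0 a0 b0 hN lm lp ne.
have vertexP M : @mon_hilb K a b h M -> hilb N M /\ torus_fixed M.
  by move=> hM; split; [exact: (mon_hilb_hilb a0 b0 hN)|apply: monomial_torus_fixed; case: hM].
split; [exact: vertexP lm.1|exact: vertexP lp.1|].
have [I [hI _ _ [B [C [hC Cg]]] [cm cp]]] := spine_ideal a0 b0 Kinf hN lm lp.
exists I; split=> //; apply: (orbit_dim a0 b0 Kinf N0 hI.1 hC Cg) => fI.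
by apply: ne; rewrite (fixed_closure N0 hI fI cm) (fixed_closure N0 hI fI cp).
Qed.

Theorem theorem1p2 (K : fieldType) (N : nat)
    (K_infinite : infinite_set [set: K]) (N_ge1 : (1 <= N)%N) :
  subgraph (spine K N) (T_graph K N) /\
  forall (a b : nat) (h : nat -> nat) (Mminus Mplus : set {mpoly K[2]}),
    (0 < a)%N -> (0 < b)%N -> sums_to h N ->
    (exists J : set {mpoly K[2]},
       [/\ is_ideal J, homogeneous a b J & hilbert_function a b J h]) ->
    lex_least a b h Mminus -> lex_most a b h Mplus ->
    exists I : set {mpoly K[2]},
      [/\ hilb N I, homogeneous a b I, hilbert_function a b I h,
          zariski_closure N (torus_orbit I) Mminus &
          zariski_closure N (torus_orbit I) Mplus].
Proof.
split; last first.
  move=> a b h Mminus Mplus a0 b0 hN _ lm lp.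
  have [I [hI gI fI _ [cm cp]]] := spine_ideal a0 b0 K_infinite hN lm lp.
  by exists I.
split=> [M [mM hM]|M M' [ne [a [b [h [a0 b0 hN [[lp lm]|[lm lp]]]]]]]].
- by split=> //; apply: monomial_torus_fixed.
- have [|? ? [I [hI dI cm cp]]] := spine_edge K_infinite N_ge1 a0 b0 hN lm lp.
    by move=> e; apply: ne.
  by split=> //; exists I.
by have [? ? ?] := spine_edge K_infinite N_ge1 a0 b0 hN lm lp ne; split.
Qed.
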